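(* Let $d,m\in\mathbb{N}$, and let $\Sigma$ and $\Omega$ be given real symmetric positive definite matrices of sizes $d\times d$ and $m\times m$, respectively. If $X\sim T_{d,m}(\nu,\Sigma,\Omega)$ (centered matrix-variate $T$ distribution with $\nu$ degrees of freedom) and $\Delta_X:=\Sigma^{-1/2}X\Omega^{-1/2}$, then $$\mathbb{E}\big[\mathrm{tr}(\Delta_X\Delta_X^{\top})\big]=\frac{md\,\nu}{\nu-2},$$ $$\mathbb{E}\big[\mathrm{tr}\big((\Delta_X\Delta_X^{\top})^2\big)\big]=\frac{md\,\nu^2\{(m+d)(\nu-2)+\nu+md\}}{(\nu-1)(\nu-2)(\nu-4)}.$$ In particular, as $\nu\to\infty$, $$\mathbb{E}\big[\mathrm{tr}(\Delta_X\Delta_X^{\top})\big]\sim md\quad\text{and}\quad\mathbb{E}\big[\mathrm{tr}\big((\Delta_X\Delta_X^{\top})^2\big)\big]\sim md(m+d+1).$$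
   Context: $|\cdot|$ denotes the determinant and $\mathrm{tr}$ the trace; $\Sigma^{-1/2}$, $\Omega^{-1/2}$ are the inverses of the symmetric positive definite square roots; $a\sim b$ means $a=(1+o(1))b$ as $\nu\to\infty$. For $\nu>0$, $T_{d,m}(\nu,\Sigma,\Omega)$ is the distribution on $\mathbb{R}^{d\times m}$ with density $$K_{\nu,\Sigma,\Omega}(X) := \frac{\Gamma_d(\frac12(\nu+m+d-1))}{\Gamma_d(\frac12(\nu+d-1))}\,\frac{|\mathrm{I}_d+\nu^{-1}\Sigma^{-1}X\Omega^{-1}X^{\top}|^{-(\nu+m+d-1)/2}}{(\nu\pi)^{md/2}|\Sigma|^{m/2}|\Omega|^{d/2}},\quad X\in\mathbb{R}^{d\times m},$$ where $\Gamma_d(z)=\pi^{d(d-1)/4}\prod_{j=1}^d\Gamma\big(z-\frac{j-1}{2}\big)$, $\Re(z)>\frac{d-1}{2}$, is the multivariate gamma function, $\Gamma$ is the classical gamma function and $\mathrm{I}_d$ is the $d\times d$ identity matrix.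
   Formalization: The first moment formula is stated for ν > 2 and the second for ν > 4; for smaller ν > 0 the expectations are infinite and the stated formulas fail or are undefined. *)

(* Defs.v *)
From HB Require Import structures.
From mathcomp Require Import all_boot all_order all_algebra.
From mathcomp Require Import all_classical all_reals all_analysis.

Set Implicit Arguments.
Unset Strict Implicit.
Unset Printing Implicit Defensive.
Import Order.TTheory GRing.Theory Num.Theory.
Import numFieldNormedType.Exports.
Local Open Scope classical_set_scope.
Local Open Scope ring_scope.

(* The sigma-algebra on matrices is the one generated by the entries; for
   T = R this is the Borel sigma-algebra of R^(d x m). *)
Definition measure_matrix_display : measure_display -> measure_display.
Proof. exact. Qed.

Section measurable_matrix.
Context {disp : measure_display} {T : measurableType disp}.
Variables d m : nat.

Definition matrix_sigma_algebra : set (set 'M[T]_(d, m)) :=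
  <<s \bigcup_(ij in [set: 'I_d * 'I_m])
        preimage_set_system setT (fun M : 'M[T]_(d, m) => M ij.1 ij.2)
          measurable >>.

Let matrix_set0 : matrix_sigma_algebra set0.
Proof. exact: sigma_algebra0. Qed.

Let matrix_setC A : matrix_sigma_algebra A -> matrix_sigma_algebra (~` A).
Proof. exact: sigma_algebraC. Qed.

Let matrix_bigcup (F : (set 'M[T]_(d, m))^nat) :
  (forall i, matrix_sigma_algebra (F i)) ->
  matrix_sigma_algebra (\bigcup_i F i).
Proof. exact: sigma_algebra_bigcup. Qed.

HB.instance Definition _ :=
  @isMeasurable.Build (measure_matrix_display disp) 'M[T]_(d, m)
    matrix_sigma_algebra matrix_set0 matrix_setC matrix_bigcup.

Lemma measurable_fun_matrix disp' (U : measurableType disp')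
    (f : U -> 'M[T]_(d, m)) :
  (forall i j, measurable_fun [set: U] (fun x => f x i j)) ->
  measurable_fun [set: U] f.
Proof.
move=> mf; apply: (@measurability _ _ _ _ _ _
  (\bigcup_(ij in [set: 'I_d * 'I_m]) preimage_set_system setT
     (fun M : 'M[T]_(d, m) => M ij.1 ij.2) measurable)) => //.
move=> _ [_ [[i j] _ [B mB <-]] <-].
by have := mf i j measurableT B mB; rewrite !setTI.
Qed.

Lemma measurable_coord (i : 'I_d) (j : 'I_m) :
  measurable_fun [set: 'M[T]_(d, m)] (fun M : 'M[T]_(d, m) => M i j).
Proof.
move=> _ B mB; apply: sub_sigma_algebra.
by exists (i, j) => //; exists B.
Qed.

End measurable_matrix.

Lemma pushforward_semi_sigma_additive d1 d2 (T1 : measurableType d1)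
    (T2 : measurableType d2) (R : realFieldType)
    (mu : {measure set T1 -> \bar R}) (f : T1 -> T2) :
  measurable_fun setT f -> semi_sigma_additive (pushforward mu f).
Proof.
move=> mf F mF tF mUF; rewrite /pushforward preimage_bigcup.
apply: measure_semi_sigma_additive.
- by move=> n; rewrite -[X in measurable X]setTI; exact: mf.
- apply/trivIsetP => /= i j _ _ ij; rewrite -preimage_setI.
  by move/trivIsetP : tF => /(_ _ _ _ _ ij) ->//; rewrite preimage_set0.
- by rewrite -preimage_bigcup -[X in measurable X]setTI; exact: mf.
Qed.

Lemma sigma_finite_product d1 d2 (T1 : measurableType d1)
    (T2 : measurableType d2) (R : realType)
    (m1 : {sigma_finite_measure set T1 -> \bar R})
    (m2 : {sigma_finite_measure set T2 -> \bar R}) :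
  sigma_finite setT (m1 \x m2)%E.
Proof.
have /sigma_finiteP[F [TF ndF Foo]] := sigma_finiteT m1.
have /sigma_finiteP[G [TG ndG Goo]] := sigma_finiteT m2.
exists (fun n => F n `*` G n).
  rewrite -setXTT TF TG predeqE => -[x y]; split.
    move=> [/= [n _ Fnx] [k _ Gky]]; exists (maxn n k) => //; split.
    - by move: x Fnx; exact/subsetPset/ndF/leq_maxl.
    - by move: y Gky; exact/subsetPset/ndG/leq_maxr.
  by move=> [n _ []/= ? ?]; split; exists n.
move=> k; have [? ?] := Foo k; have [? ?] := Goo k.
split; first exact: measurableX.
by rewrite product_measure1E// lte_mul_pinfty// ge0_fin_numE.
Qed.

(* Lebesgue measure on R^n, by induction on n:
   lambda_0 is the Dirac mass at the empty tuple and lambda_(n+1) is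
   lambda_1 \x lambda_n transported along (x, t) |-> x :: t. *)
Section lebesgue_tuple.
Context {R : realType}.
Local Open Scope ereal_scope.

Definition tuple_cons n (p : measurableTypeR R * n.-tuple R) : n.+1.-tuple R :=
  [the n.+1.-tuple R of p.1 :: p.2].

Lemma measurable_tuple_cons n : measurable_fun setT (@tuple_cons n).
Proof. exact: measurable_cons. Qed.

Section step.
Variables (n : nat) (mu : {sigma_finite_measure set (n.-tuple R) -> \bar R}).

Definition lebesgue_tuple_step : set (n.+1.-tuple R) -> \bar R :=
  pushforward (@lebesgue_measure R \x mu) (@tuple_cons n).

Let step0 : lebesgue_tuple_step set0 = 0.
Proof. by rewrite /lebesgue_tuple_step /pushforward preimage_set0 measure0. Qed.

Let step_ge0 A : 0 <= lebesgue_tuple_step A.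
Proof. by rewrite /lebesgue_tuple_step /pushforward measure_ge0. Qed.

Let step_sigma_additive : semi_sigma_additive lebesgue_tuple_step.
Proof.
apply: pushforward_semi_sigma_additive; exact: measurable_tuple_cons.
Qed.

HB.instance Definition _ := isMeasure.Build _ _ _ lebesgue_tuple_step
  step0 step_ge0 step_sigma_additive.

Let step_sigma_finite : sigma_finite setT lebesgue_tuple_step.
Proof.
have [F TF Foo] := sigma_finite_product (@lebesgue_measure R) mu.
pose g (t : n.+1.-tuple R) : measurableTypeR R * n.-tuple R :=
  (thead t, [tuple of behead t]).
have gK : cancel g (@tuple_cons n).
  by move=> t; rewrite /tuple_cons /= [RHS]tuple_eta; apply: val_inj.
have cK : cancel (@tuple_cons n) g.
  by move=> [x t]; rewrite /g /tuple_cons /= theadE; congr pair; exact: val_inj.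
have mg : measurable_fun setT g.
  apply/measurable_fun_pairP; split => /=; last exact: measurable_behead.
  exact: measurable_tnth.
exists (fun i => g @^-1` F i).
  by rewrite -preimage_bigcup -TF preimage_setT.
move=> i; have [mFi Fioo] := Foo i; split.
  by rewrite -[X in measurable X]setTI; exact: mg.
rewrite /lebesgue_tuple_step /pushforward (_ : _ @^-1` _ = F i)//.
by apply/seteqP; split => p /=; rewrite cK.
Qed.

HB.instance Definition _ := Measure_isSigmaFinite.Build _ _ _
  lebesgue_tuple_step step_sigma_finite.

End step.

Fixpoint lebesgue_tuple n : {sigma_finite_measure set (n.-tuple R) -> \bar R} :=
  match n with
  | 0 => [the {sigma_finite_measure set (0.-tuple R) -> \bar R} of
           \d_([tuple] : 0.-tuple R)]
  | n'.+1 => [the {sigma_finite_measure set (n'.+1.-tuple R) -> \bar R} of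
           lebesgue_tuple_step (lebesgue_tuple n')]
  end.

End lebesgue_tuple.

Section lebesgue_matrix.
Context {R : realType}.
Variables d m : nat.
Local Open Scope ereal_scope.

Definition matrix_of_tuple (t : (d * m).-tuple R) : 'M[R]_(d, m) :=
  \matrix_(i, j) tnth t (mxvec_index i j).

Lemma measurable_matrix_of_tuple : measurable_fun setT matrix_of_tuple.
Proof.
apply: measurable_fun_matrix => i j.
under eq_fun do rewrite mxE.
exact: measurable_tnth.
Qed.

Definition lebesgue_matrix : set 'M[R]_(d, m) -> \bar R :=
  pushforward (lebesgue_tuple (d * m)) matrix_of_tuple.

Let lebesgue_matrix0 : lebesgue_matrix set0 = 0.
Proof. by rewrite /lebesgue_matrix /pushforward preimage_set0 measure0. Qed.

Let lebesgue_matrix_ge0 A : 0 <= lebesgue_matrix A.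
Proof. by rewrite /lebesgue_matrix /pushforward measure_ge0. Qed.

Let lebesgue_matrix_sigma_additive : semi_sigma_additive lebesgue_matrix.
Proof.
apply: pushforward_semi_sigma_additive; exact: measurable_matrix_of_tuple.
Qed.

HB.instance Definition _ := isMeasure.Build _ _ _ lebesgue_matrix
  lebesgue_matrix0 lebesgue_matrix_ge0 lebesgue_matrix_sigma_additive.

End lebesgue_matrix.
Arguments lebesgue_matrix {R} d m.

Section matrix_T.
Context {R : realType}.

Definition posdefmx n (A : 'M[R]_n) : Prop :=
  A^T = A /\ forall v : 'cV[R]_n, v != 0 -> 0 < (v^T *m A *m v) ord0 ord0.

(* For positive definite A this is the unique symmetric positive definite
   square root; the default value 0 is only used when there is none. *)
Definition sqrtmx n (A : 'M[R]_n) : 'M[R]_n :=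
  xget 0 [set S : 'M[R]_n | posdefmx S /\ S *m S = A].

Definition Gamma (z : R) : R :=
  \int[@lebesgue_measure R]_(t in `]0, +oo[) (t `^ (z - 1) * expR (- t)).

(* With j running over 0, .., d - 1, the shift (j - 1) / 2 becomes j / 2. *)
Definition multi_Gamma (d : nat) (z : R) : R :=
  pi `^ ((d * d.-1)%N%:R / 4) * \prod_(j < d) Gamma (z - j%:R / 2).

Definition matrix_T_density (d m : nat) (nu : R)
    (Sigma : 'M[R]_d) (Omega : 'M[R]_m) (X : 'M[R]_(d, m)) : R :=
  multi_Gamma d ((nu + m%:R + d%:R - 1) / 2)
    / multi_Gamma d ((nu + d%:R - 1) / 2)
  * (\det (1%:M + nu^-1 *: (invmx Sigma *m X *m invmx Omega *m X^T))
       `^ (- ((nu + m%:R + d%:R - 1) / 2))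
     / ((nu * pi) `^ ((m * d)%N%:R / 2)
        * \det Sigma `^ (m%:R / 2) * \det Omega `^ (d%:R / 2))).

(* X ~ T_{d,m}(nu, Sigma, Omega) *)
Definition matrix_T_distributed (d m : nat) (disp : measure_display)
    (W : measurableType disp) (P : probability W R)
    (X : {RV P >-> 'M[R]_(d, m)}) (nu : R)
    (Sigma : 'M[R]_d) (Omega : 'M[R]_m) : Prop :=
  forall A : set 'M[R]_(d, m), measurable A ->
    distribution P X A =
    (\int[lebesgue_matrix d m]_(x in A)
       (matrix_T_density nu Sigma Omega x)%:E)%E.

Definition standardize (d m : nat) (Sigma : 'M[R]_d) (Omega : 'M[R]_m)
    (X : 'M[R]_(d, m)) : 'M[R]_(d, m) :=
  invmx (sqrtmx Sigma) *m X *m invmx (sqrtmx Omega).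

(* a = (1 + o(1)) b at +oo *)
Definition asymp_equiv (a b : R -> R) : Prop :=
  exists2 e : R -> R, e nu @[nu --> +oo] --> (0 : R) &
    \forall nu \near +oo, a nu = (1 + e nu) * b nu.

End matrix_T.

(* Main.v *)
(** The density of [X] is [K = C * D^(-a)] with [D = det (1 + Q / nu)], where
    [Q = X Omega^-1 X^T Sigma^-1] and [a = (nu + m + d - 1) / 2], and
    [tr ((Delta_X Delta_X^T)^k) = tr (Q^k)].  By Jacobi's formula, the derivative
    of [log D] along a vector field of the form [V = (1 + Q / nu) W] is
    [(2 / nu) tr (W Omega^-1 X^T Sigma^-1)], so that integrating the divergence
    of [V K] over the space of matrices gives linear relations between the
    moments of [X].  The field [W = X] yields [(nu - 2) E[tr Q] = nu m d], and
    [W = (nu - 2) Q X + (tr Q) X] yields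
    [(nu - 1) (nu - 4) E[tr (Q^2)] =
       nu ((m + d) (nu - 2) + nu + m d) E[tr Q]].
    The boundary terms are removed by the damping factor [exp (- e tr Q)]: the
    extra term it produces has a sign, which gives the finiteness of the moments
    by monotone convergence, and it vanishes in the limit [e -> 0] by dominated
    convergence.  The total mass of [K] is [1] because [K] is the density of a
    probability measure, so no gamma integral has to be computed. *)
Require Import Defs.
From mathcomp Require Import all_boot all_order all_algebra.
From mathcomp Require Import perm complex ring lra.
From mathcomp Require Import all_classical all_reals all_analysis measurable_realfun.
Import Order.TTheory GRing.Theory Num.Theory.
Import numFieldNormedType.Exports.

Set Implicit Arguments.
Unset Strict Implicit.
Unset Printing Implicit Defensive.
Local Open Scope classical_set_scope.
Local Open Scope ring_scope.

(** * Positive definite matrices *)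

(** The density decays only polynomially, so neither the integrability of the divergence of [V K]
    nor the vanishing of its boundary terms is clear beforehand; with the damping, every integrand
    is a bounded function times [K]. The price is a term of one degree more in [Q] than the moment
    sought ([tr (Q^2)] for the first relation, [tr (Q^3)] for the second), whose expectation is not
    known to be finite. Since [x * exp (-x) <= 1], one factor [e * tr Q] of it is absorbed uniformly
    in [e], and the moment sought and the previous one bound the rest. The factor [1 + Q / nu] in
    the fields turns the adjugate of Jacobi's formula into the determinant, so that dividing by [D]
    leaves a polynomial. For the second relation, [W = Q X] and [W = (tr Q) X] taken separately
    involve both [E[tr (Q^2)]] and [E[(tr Q)^2]]; their combination leaves one nonnegative unknown
    with a positive coefficient, the shape that the monotone convergence argument requires. *)

Lemma sqr_sum_le (R : realFieldType) (I : finType) (a b : I -> R) :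
  (\sum_i a i * b i) ^+ 2 <= (\sum_i a i ^+ 2) * (\sum_i b i ^+ 2).
Proof.
have h : 0 <= \sum_i \sum_j (a i * b j - a j * b i) ^+ 2.
  by apply: sumr_ge0 => i _; apply: sumr_ge0 => j _; exact: sqr_ge0.
(* Lagrange's identity: the defect in the Cauchy-Schwarz inequality is half a sum of squares of 2 by
   2 minors. *)
have e : \sum_i \sum_j (a i * b j - a j * b i) ^+ 2 =
    2 * ((\sum_i a i ^+ 2) * (\sum_i b i ^+ 2) - (\sum_i a i * b i) ^+ 2).
  transitivity (\sum_i \sum_j (a i ^+ 2 * b j ^+ 2 + b i ^+ 2 * a j ^+ 2
      - 2 * ((a i * b i) * (a j * b j)))).
    by apply: eq_bigr => i _; apply: eq_bigr => j _; ring.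
  under eq_bigr do rewrite sumrB big_split -!mulr_sumr/=.
  rewrite sumrB big_split/= -!mulr_suml -mulr_sumr -mulr_suml; ring.
by move: h; rewrite e pmulr_rge0// subr_ge0.
Qed.

(** * The squared Frobenius norm as the trace of a Gram matrix *)

Section frobenius.
Context {R : realFieldType}.

Lemma mxtrace_gramE p q (A : 'M[R]_(p, q)) :
  \tr (A *m A^T) = \sum_i \sum_j A i j ^+ 2.
Proof.
apply: eq_bigr => i _; rewrite mxE.
by apply: eq_bigr => j _; rewrite mxE expr2.
Qed.

Lemma mxtrace_gram_ge0 p q (A : 'M[R]_(p, q)) : 0 <= \tr (A *m A^T).
Proof.
by rewrite mxtrace_gramE; do 2 apply: sumr_ge0 => ? _; exact: sqr_ge0.
Qed.

(** Cauchy-Schwarz for each entry of the product. The comparisons between [tr Q], [tr (Q^2)] and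
    [tr (Q^3)] all come from this submultiplicativity. *)
Lemma mxtrace_gramM_le p q r (A : 'M[R]_(p, q)) (B : 'M[R]_(q, r)) :
  \tr (A *m B *m (A *m B)^T) <= \tr (A *m A^T) * \tr (B *m B^T).
Proof.
rewrite [X in _ <= _ * X]mxtrace_gramE exchange_big !mxtrace_gramE/= mulr_suml.
apply: ler_sum => i _; rewrite mulr_sumr; apply: ler_sum => j _.
by rewrite mxE; exact: sqr_sum_le.
Qed.

Lemma coord_le_mxtrace_gram p q (A : 'M[R]_(p, q)) i j :
  A i j ^+ 2 <= \tr (A *m A^T).
Proof.
rewrite mxtrace_gramE (bigD1 i)//= (bigD1 j)//= -addrA lerDl addr_ge0//.
  by apply: sumr_ge0 => ? _; exact: sqr_ge0.
by do 2 apply: sumr_ge0 => ? _; exact: sqr_ge0.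
Qed.

Lemma mxtrace_gram_gt0 p q (A : 'M[R]_(p, q)) : A != 0 -> 0 < \tr (A *m A^T).
Proof.
move=> /matrix0Pn[i [j Aij]]; apply: lt_le_trans (coord_le_mxtrace_gram A i j).
by rewrite exprn_even_gt0.
Qed.

End frobenius.

Lemma tr_horner_mx (F : comNzRingType) n (A : 'M[F]_n.+1) (p : {poly F}) :
  A^T = A -> (horner_mx A p)^T = horner_mx A p.
Proof.
move=> sA; elim/poly_ind: p => [|p c IH]; first by rewrite !rmorph0 trmx0.
rewrite rmorphD rmorphM /= horner_mx_C horner_mx_X linearD /= tr_scalar_mx.
rewrite [in LHS]/GRing.mul/= trmx_mul IH sA; congr (_ + _).
rewrite -{1}[A]horner_mx_X -[X in _ = _ * X]horner_mx_X.
exact: comm_horner_mx2.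
Qed.

(** Newton interpolation: a correction proportional to the nodal polynomial of the earlier points
    keeps the earlier values. It gives a functional calculus by real polynomials. *)
Lemma poly_interpolation (F : fieldType) (f : F -> F) (s : seq F) :
  exists p : {poly F}, forall x, x \in s -> p.[x] = f x.
Proof.
elim: s => [|x s [p hp]]; first by exists 0.
have [xs|xs] := boolP (x \in s).
  by exists p => y; rewrite inE => /predU1P[->|]; exact: hp.
pose q := \prod_(y <- s) ('X - y%:P).
have qx : q.[x] != 0.
  by have := root_prod_XsubC s x; rewrite (negbTE xs) rootE -/q => /negbT.
exists (p + ((f x - p.[x]) / q.[x])%:P * q) => y.
rewrite inE hornerD hornerM hornerC => /predU1P[->|ys]; first by rewrite divfK// addrC subrK.
have /eqP -> : root q y by rewrite root_prod_XsubC.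
by rewrite mulr0 addr0 hp.
Qed.

(** * Spectral theory of real symmetric matrices *)

Section symmetric_real.
Context {R : realType}.
Local Notation C := (real_complex R).

(** Unitary diagonalization of the Hermitian matrix [map_mx C A], whose spectrum is real. Only [P]
    stays complex, so facts about [A] return to the reals through the injectivity of
    [real_complex]. *)
Lemma symmetric_real_diagonalizable n (A : 'M[R]_n) : A^T = A ->
  exists (P : 'M[R[i]]_n) (s : 'rV[R]_n), P \in unitmx /\
    map_mx C A = invmx P *m diag_mx (map_mx C s) *m P.
Proof.
move=> sA; set B := map_mx C A.
have hB : B \is hermsymmx.
  apply: realsym_hermsym.
    by apply/is_hermitianmxP; rewrite expr0 scale1r map_mx_id// map_trmx sA.
  by apply/mxOverP => i j; rewrite mxE; apply/complex_realP; exists (A i j).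
have /orthomx_spectralP eB := hermitian_normalmx hB.
exists (spectralmx B), (map_mx (@complex.Re R) (spectral_diag B)).
split; first exact: spectral_unit.
rewrite {1}eB; congr (_ *m diag_mx _ *m _).
apply/matrixP => i j; rewrite !mxE.
by rewrite RRe_real//; exact: (mxOverP (hermitian_spectral_diag_real hB)).
Qed.

Lemma diagonalization_eigenvalue n (A : 'M[R]_n) (P : 'M[R[i]]_n) (s : 'rV[R]_n) k :
  P \in unitmx -> map_mx C A = invmx P *m diag_mx (map_mx C s) *m P ->
  eigenvalue A (s 0 k).
Proof.
move=> uP eA; rewrite -(eigenvalue_map C) eA.
apply/eigenvalueP; exists (row k P); last first.
  apply/eqP => rk0; have : \rank P = n by rewrite mxrank_unit.
  have : row k 1%:M = 0 :> 'rV[R[i]]_n by rewrite -(mulmxV uP) row_mul rk0 mul0mx.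
  by move/rowP/(_ k)/eqP; rewrite !mxE eqxx oner_eq0.
rewrite -row_mul !mulmxA mulmxV// mul1mx row_mul row_diag_mx -scalemxAl -rowE.
by rewrite mxE.
Qed.

Lemma posdefmx_eigenvalue_gt0 n (A : 'M[R]_n) a : posdefmx A ->
  eigenvalue A a -> 0 < a.
Proof.
move=> [_ pA] /eigenvalueP[v vA v0].
have := pA v^T; rewrite trmx_eq0 v0 trmxK => /(_ isT).
by rewrite vA -scalemxAl mxE -trace_mx11 pmulr_lgt0// mxtrace_gram_gt0.
Qed.

Lemma gram_eigenvalue_ge0 n m (B : 'M[R]_(n, m)) a :
  eigenvalue (B *m B^T) a -> 0 <= a.
Proof.
move=> /eigenvalueP[v vA v0].
rewrite -(pmulr_lge0 _ (mxtrace_gram_gt0 v0)) -mxtraceZ scalemxAl -vA.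
by rewrite mulmxA -[_ *m v^T]mulmxA -trmx_mul mxtrace_gram_ge0.
Qed.

(** The determinant is the product of the [1 + s 0 k], where the eigenvalues [s 0 k] of a Gram
    matrix are nonnegative. This is what makes [1 / D] bounded by 1 and [ln D] nonnegative in the
    estimates. *)
Lemma det1D_gram_ge1 n m (B : 'M[R]_(n, m)) : 1 <= \det (1%:M + B *m B^T).
Proof.
have sB : (B *m B^T)^T = B *m B^T by rewrite trmx_mul trmxK.
have [P [s [uP eB]]] := symmetric_real_diagonalizable sB.
have -> : \det (1%:M + B *m B^T) = \prod_k (1 + s 0 k).
  apply: (@complexI R); rewrite -det_map_mx map_mxD map_mx1 eB.
  have -> : 1%:M + invmx P *m diag_mx (map_mx C s) *m P =
     invmx P *m (diag_mx (map_mx C (const_mx 1 + s))) *m P.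
    rewrite map_mxD raddfD/= mulmxDr mulmxDl; congr (_ + _).
    by rewrite map_const_mx rmorph1 diag_const_mx mulmx1 mulVmx.
  rewrite !det_mulmx det_inv mulrAC mulVr; last first.
    by rewrite -unitmxE.
  rewrite mul1r det_diag rmorph_prod/=.
  by apply: eq_bigr => k _; rewrite !mxE.
elim/big_rec: _ => // k x _ x1.
have := gram_eigenvalue_ge0 (diagonalization_eigenvalue k uP eB).
by move=> s0; rewrite mulr_ege1// lerDl.
Qed.

(** Conjugating by the complex [P] would not visibly give a real matrix, so the root is built from a
    real polynomial in [A], which is automatically symmetric. That polynomial interpolates the
    fourth root: with [B] symmetric and [S = B *m B], the form of [S] at [v] is the squared norm of
    [B *m v]. *)
Lemma posdefmx_sqrt_exists n (A : 'M[R]_n) : posdefmx A ->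
  exists S : 'M[R]_n, posdefmx S /\ S *m S = A.
Proof.
case: n A => [|n] A pA.
  by exists A; split => //; apply/matrixP => -[].
have [sA posA] := pA.
have [P [s [uP eA]]] := symmetric_real_diagonalizable sA.
have spos k : 0 < s 0 k.
  exact: posdefmx_eigenvalue_gt0 pA (diagonalization_eigenvalue k uP eA).
(* A polynomial that vanishes on the spectrum annihilates [A], because [A] is diagonalizable over
   the complex numbers. *)
have hA q : (forall k, q.[s 0 k] = 0) -> horner_mx A q = 0.
  move=> q0; have : map_mx C (horner_mx A q) = 0.
    rewrite map_horner_mx eA horner_mx_uconjC// horner_mx_diag.
    rewrite (_ : map_mx _ _ = 0) ?linear0 ?mulmx0 ?mul0mx//.
    by apply/rowP => k; rewrite !mxE horner_map q0 rmorph0.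
  by move/eqP; rewrite map_mx_eq0 => /eqP.
have [p hp] := poly_interpolation (fun x => Num.sqrt (Num.sqrt x)) [seq s 0 k | k : 'I_n.+1].
have hpk k : p.[s 0 k] = Num.sqrt (Num.sqrt (s 0 k)).
  by rewrite hp//; apply/mapP; exists k => //; rewrite mem_enum.
pose B := horner_mx A p.
have sB : B^T = B by exact: tr_horner_mx.
have B4 : B *m B *m (B *m B) = A.
  apply/eqP; rewrite -subr_eq0; apply/eqP.
  have -> : B *m B *m (B *m B) - A = horner_mx A (p * p * (p * p) - 'X).
    by rewrite rmorphB /= horner_mx_X !rmorphM.
  apply: hA => k; rewrite hornerD hornerN hornerX !hornerM hpk.
  by rewrite -!expr2 sqr_sqrtr ?sqrtr_ge0// sqr_sqrtr ?subrr// ltW.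
exists (B *m B); split => //; split; first by rewrite trmx_mul sB.
move=> v v0.
have -> : v^T *m (B *m B) *m v = (B *m v)^T *m (B *m v).
  by rewrite trmx_mul sB !mulmxA.
have Bv0 : B *m v != 0.
  apply/eqP => Bv; have := posA v v0.
  by rewrite -B4 -!mulmxA Bv !mulmx0 mxE ltxx.
by rewrite -[X in _ *m X]trmxK -trace_mx11 mxtrace_gram_gt0 ?trmx_eq0.
Qed.

Lemma posdefmx_sqrtmx n (A : 'M[R]_n) : posdefmx A ->
  posdefmx (sqrtmx A) /\ sqrtmx A *m sqrtmx A = A.
Proof.
by move=> /posdefmx_sqrt_exists h; have [S hS] := h; exact: (xgetPex 0 h).
Qed.

Lemma posdefmx_unit n (A : 'M[R]_n) : posdefmx A -> A \in unitmx.
Proof.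
move=> [_ pA]; rewrite -row_free_unit -kermx_eq0; apply/eqP/row_matrixP => i.
rewrite row0; apply/eqP/negP => /negP v0.
have /sub_kermxP vA : (row i (kermx A) <= kermx A)%MS by exact: row_sub.
have := pA (row i (kermx A))^T; rewrite trmx_eq0 v0 trmxK vA mul0mx mxE ltxx.
by move/(_ isT).
Qed.

End symmetric_real.

(** * Measures with a density *)

Section density.
Local Open Scope ereal_scope.
Context d (T : measurableType d) (R : realType).
Variables (mu nu : {measure set T -> \bar R}) (f : T -> R).
Hypothesis mf : measurable_fun [set: T] f.
Hypothesis f0 : forall x, (0 <= f x)%R.
Hypothesis nuE : forall A, measurable A -> nu A = \int[mu]_(x in A) (f x)%:E.

Import HBNNSimple.

(** [nuE] is the case of indicators; linearity gives simple functions, and monotone convergence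
    along the same approximating sequence on both sides gives the rest. *)
Lemma ge0_integral_density (g : T -> \bar R) : measurable_fun [set: T] g ->
  (forall x, 0 <= g x) -> \int[nu]_x g x = \int[mu]_x (g x * (f x)%:E).
Proof.
move=> mg g0; pose h := nnsfun_approx measurableT mg.
have cvh x : (EFin \o h n) x @[n --> \oo] --> g x by exact: cvg_nnsfun_approx.
have mh n : measurable_fun setT (EFin \o h n) by exact/measurable_EFinP.
have ndh x : {homo (fun n => (EFin \o h n) x) : a b / (a <= b)%N >-> a <= b}.
  by move=> a b ab; rewrite lee_fin; exact/lefP/nd_nnsfun_approx.
have mfE : measurable_fun setT (EFin \o f) by exact/measurable_EFinP.
have -> : \int[nu]_x g x = limn (fun n => \int[nu]_x (EFin \o h n) x).
  rewrite -monotone_convergence//.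
    by apply: eq_integral => x _; apply/esym/cvg_lim => //; exact: cvh.
  by move=> n x _; rewrite lee_fin.
have -> : \int[mu]_x (g x * (f x)%:E) =
    limn (fun n => \int[mu]_x ((EFin \o h n) x * (f x)%:E)).
  rewrite -monotone_convergence//.
  - apply: eq_integral => x _; apply/esym/cvg_lim => //.
    by apply: cvgeZr => //; exact: cvh.
  - by move=> n; exact: emeasurable_funM.
  - by move=> n x _; rewrite mule_ge0 ?lee_fin.
  - by move=> x _ a b ab; rewrite lee_wpmul2r ?lee_fin//; exact: ndh.
congr (limn _); apply/funext => n.
have hE x : (h n x)%:E = \sum_(y \in range (h n)) (y * \1_(h n @^-1` [set y]) x)%:E.
  by rewrite fimfunE -fsumEFin.
have mind r : measurable_fun setT (fun x => (r * \1_(h n @^-1` [set r]) x)%:E).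
  by apply/measurable_EFinP; exact: measurable_funM.
under eq_integral do rewrite /= hE.
under [RHS]eq_integral => x _.
  rewrite /= hE ge0_mule_fsuml => [|y]; last exact: nnfun_muleindic_ge0.
  over.
rewrite ge0_integral_fsum//; last by move=> r x _; exact: nnfun_muleindic_ge0.
rewrite ge0_integral_fsum//; last 2 first.
- by move=> r; exact: emeasurable_funM.
- by move=> r x _; rewrite mule_ge0 ?lee_fin//; exact: nnfun_muleindic_ge0.
apply: eq_fsbigr => r; rewrite inE => -[x0 _ <-]; set y := h n x0.
have mA : measurable (h n @^-1` [set y]) by [].
under eq_integral do rewrite EFinM.
rewrite ge0_integralZl//; last 2 first.
- exact/measurable_EFinP.
- by rewrite lee_fin.
rewrite integral_indic// setIT nuE//.
under [RHS]eq_integral do rewrite EFinM -muleA.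
rewrite [RHS]ge0_integralZl//; last 3 first.
- by apply: emeasurable_funM => //; exact/measurable_EFinP.
- by move=> x _; rewrite mule_ge0// lee_fin.
- by rewrite lee_fin.
congr (_ * _); rewrite integral_mkcond; apply: eq_integral => x _.
rewrite patchE indicE.
by case: ifPn => _; rewrite ?mul1e ?mul0e.
Qed.

Lemma integrable_density (g : T -> R) : measurable_fun [set: T] g ->
  mu.-integrable [set: T] (fun x => (g x * f x)%:E) ->
  nu.-integrable [set: T] (EFin \o g).
Proof.
move=> mg /integrableP[_ ig]; apply/integrableP; split.
  exact/measurable_EFinP.
rewrite ge0_integral_density//; last first.
  by apply/measurable_EFinP/measurableT_comp.
move: ig; under eq_integral do rewrite /= normrM [X in (_ * X)%R]ger0_norm// EFinM.
exact.
Qed.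

(** Multiplication by the nonnegative [f] commutes with positive and negative parts, so both
    integrals are the same difference, infinite values included. *)
Lemma integral_density (g : T -> R) : measurable_fun [set: T] g ->
  \int[nu]_x (g x)%:E = \int[mu]_x (g x * f x)%:E.
Proof.
move=> mg.
have mgE : measurable_fun setT (EFin \o g) by exact/measurable_EFinP.
rewrite integralE [RHS]integralE.
rewrite (ge0_integral_density (g := (fun x => (g x)%:E)^\+))//; last exact: measurable_funepos.
rewrite (ge0_integral_density (g := (fun x => (g x)%:E)^\-))//; last exact: measurable_funeneg.
congr (_ - _); apply: eq_integral => x _.
  by rewrite !funeposE -!EFin_max -EFinM maxr_pMl// mul0r.
by rewrite !funenegE -!EFinN -!EFin_max -EFinM maxr_pMl// mul0r mulNr.
Qed.

End density.

(** * Integration by parts in one matrix entry *)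

(** The fundamental theorem of calculus on growing symmetric intervals, with truncated integrals
    dominated by [|f|]. *)
Lemma integral_derive_vanishing (R : realType) (F f : R -> R) :
  (forall x : R, is_derive x (1 : R) F (f x)) -> continuous f ->
  (@lebesgue_measure R).-integrable setT (EFin \o f) ->
  F n%:R @[n --> \oo] --> (0 : R) -> F (- n%:R) @[n --> \oo] --> (0 : R) ->
  (\int[@lebesgue_measure R]_x (f x)%:E = 0)%E.
Proof.
move=> dF cf intf Fp Fn.
have mf : measurable_fun setT f by exact: continuous_measurable_fun.
(* The shift to [n.+1] keeps the interval nondegenerate at [n = 0], as the fundamental theorem
   requires. *)
pose I n := `[- (n.+1%:R : R), n.+1%:R].
pose g n x := ((f \_ [set` I n]) x)%:E.
have mg n : measurable_fun setT (g n).
  apply/measurable_EFinP; apply/(measurable_restrictT _ _).1 => //.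
  exact: measurable_funTS.
have cvg_g x : g ^~ x @ \oo --> (f x)%:E.
  apply: cvg_near_cst; near=> n; rewrite /g patchE.
  rewrite ifT// inE/= in_itv/= -ler_norml.
  near: n; exists (Num.trunc `|x|) => // n /= hn.
  by rewrite (le_trans (ltW (truncnS_gt _)))// ler_nat ltnS.
have [|||||_ _ cv] := @dominated_convergence _ _ _ (@lebesgue_measure R) setT
    measurableT g (EFin \o f) (abse \o (EFin \o f)).
- exact: mg.
- exact/measurable_EFinP.
- by apply: aeW => x _; exact: cvg_g.
- exact: integrable_abse.
- apply: aeW => x n _; rewrite /g patchE; case: ifPn => // _.
  by rewrite abse0 abse_ge0.
rewrite -[LHS](cvg_lim (@ereal_hausdorff R) cv); apply/cvg_lim => //=.
have -> : (fun n => \int[@lebesgue_measure R]_x g n x)%E =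
    (fun n => (F n.+1%:R - F (- n.+1%:R))%:E).
  apply/funext => n.
  rewrite (_ : g n = (EFin \o f) \_ [set` I n]); last first.
    by apply/funext => x; rewrite /g !patchE; case: ifPn.
  rewrite -integral_mkcond.
  rewrite (@continuous_FTC2 _ f F)//.
  - by rewrite (lt_trans (y := 0))// oppr_lt0.
  - exact: continuous_subspaceT.
  - have cF x : {for x, continuous F}.
      by apply: differentiable_continuous; apply/derivable1_diffP; exact: ex_derive.
    split.
    + by move=> x _; exact: ex_derive.
    + by apply: cvg_at_right_filter; exact: cF.
    + by apply: cvg_at_left_filter; exact: cF.
  - by move=> x _; rewrite derive1E; exact: derive_val.
apply: cvg_EFin; first by near=> n.
rewrite /comp/= -[X in _ --> X](subrr 0); apply: cvgB.
  by move: Fp; rewrite -(cvg_shiftS (fun n => F n%:R)).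
by move: Fn; rewrite -(cvg_shiftS (fun n => F (- n%:R))).
Unshelve. all: by end_near. Qed.

(** * Fubini along one coordinate *)

Section lebesgue_tuple_coord.
Context {R : realType}.
Local Open Scope ereal_scope.

Definition tuple_set n (k : 'I_n) (t : n.-tuple R) (y : R) : n.-tuple R :=
  [tuple if i == k then y else tnth t i | i < n].

Lemma tuple_set_cons0 n (t : n.-tuple R) (x y : R) :
  tuple_set ord0 (tuple_cons (x, t)) y = tuple_cons (y, t).
Proof.
apply: eq_from_tnth => i; rewrite tnth_mktuple.
case: (unliftP ord0 i) => [j|] ->; last by rewrite eqxx tnth0.
by rewrite eq_sym (negbTE (neq_lift _ _)) !tnthS.
Qed.

Lemma tuple_set_consS n (k : 'I_n) (t : n.-tuple R) (x y : R) :
  tuple_set (lift ord0 k) (tuple_cons (x, t)) y = tuple_cons (x, tuple_set k t y).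
Proof.
apply: eq_from_tnth => i; rewrite tnth_mktuple.
case: (unliftP ord0 i) => [j|] ->; last by rewrite (negbTE (neq_lift _ _)) !tnth0.
by rewrite (inj_eq lift_inj) !tnthS tnth_mktuple.
Qed.

(** Induction along the construction of the measure: coordinate 0 is integrated first by Fubini, any
    other one is reached by fixing coordinate 0. Since Fubini makes only almost every slice
    integrable, the vanishing hypothesis is conditional on integrability of the slice. *)
Lemma integral_lebesgue_tuple_coord0 n (k : 'I_n) (F : n.-tuple R -> R) :
  measurable_fun setT F ->
  (lebesgue_tuple n).-integrable setT (EFin \o F) ->
  (forall t, (@lebesgue_measure R).-integrable setT
       (fun y => (F (tuple_set k t y))%:E) ->
     \int[@lebesgue_measure R]_y (F (tuple_set k t y))%:E = 0) ->
  \int[lebesgue_tuple n]_t (F t)%:E = 0.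
Proof.
elim: n k F => [[]//|n IH] k F mF iF F0.
have mcons := @measurable_tuple_cons R n.
pose f (p : measurableTypeR R * n.-tuple R) := (F (tuple_cons p))%:E.
have mf : measurable_fun setT f.
  by apply/measurable_EFinP; exact: measurableT_comp.
have mFE : measurable_fun setT (EFin \o F) by exact/measurable_EFinP.
have ifp : (@lebesgue_measure R \x lebesgue_tuple n).-integrable setT f.
  apply/integrableP; split => //.
  have /integrableP[_] := iF.
  rewrite /= ge0_integral_pushforward//.
  by apply/measurable_EFinP; exact: measurableT_comp.
have -> : \int[lebesgue_tuple n.+1]_t (F t)%:E =
    \int[@lebesgue_measure R \x lebesgue_tuple n]_p f p.
  by rewrite /= integral_pushforward.
case: (unliftP ord0 k) F0 => [k'|] -> F0.
- rewrite -(integral12_prod_meas1 ifp) (ae_eq_integral (cst 0))//.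
  + by rewrite integral_cst ?mul0e.
  + exact: (measurable_fubini_F ifp).
  + have := ae_integrable1 ifp; apply: filterS => x ix _ /=.
    apply: (IH k' (fun t => F (tuple_cons (x, t)))) => //.
      by do 2 apply: measurableT_comp => //.
    move=> t iy; have := F0 (tuple_cons (x, t)).
    by under eq_fun do rewrite tuple_set_consS; exact.
- rewrite -(integral21_prod_meas1 ifp) (ae_eq_integral (cst 0))//.
  + by rewrite integral_cst ?mul0e.
  + exact: (measurable_fubini_G ifp).
  + have := ae_integrable2 ifp; apply: filterS => t it _ /=.
    have := F0 (tuple_cons (0%R, t)).
    by under eq_fun do rewrite tuple_set_cons0; exact.
Qed.

End lebesgue_tuple_coord.

Section lebesgue_matrix_coord.
Context {R : realType} (d m : nat).
Local Open Scope ereal_scope.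

Lemma matrix_of_tuple_set (i : 'I_d) (j : 'I_m) t (y : R) :
  matrix_of_tuple (tuple_set (mxvec_index i j) t y) =
  (matrix_of_tuple (tuple_set (mxvec_index i j) t 0) + y *: delta_mx i j)%R.
Proof.
apply/matrixP => k l; rewrite !mxE !tnth_mktuple.
have -> : (mxvec_index k l == mxvec_index i j) = (k == i) && (l == j).
  apply/eqP/andP => [e|[/eqP-> /eqP->]//].
  by have := enum_rank_inj (cast_ord_inj e); case=> -> ->.
by case: ifPn => _; rewrite ?mulr1 ?add0r ?mulr0 ?addr0.
Qed.

Lemma integral_partial_derivative0 (i : 'I_d) (j : 'I_m) (F f : 'M[R]_(d, m) -> R) :
  measurable_fun setT f ->
  (lebesgue_matrix d m).-integrable setT (EFin \o f) ->
  (forall X (y : R), is_derive y (1 : R)%R (fun s => F (X + s *: delta_mx i j)%R)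
     (f (X + y *: delta_mx i j)%R)) ->
  (forall X, continuous (fun s : R => f (X + s *: delta_mx i j)%R)) ->
  (forall X, F (X + n%:R *: delta_mx i j)%R @[n --> \oo] --> (0 : R)%R) ->
  (forall X, F (X + - n%:R *: delta_mx i j)%R @[n --> \oo] --> (0 : R)%R) ->
  \int[lebesgue_matrix d m]_X (f X)%:E = 0.
Proof.
move=> mf if_ dF cf Fp Fn.
have mm := @measurable_matrix_of_tuple R d m.
have mfE : measurable_fun setT (EFin \o f) by exact/measurable_EFinP.
have ift : (lebesgue_tuple (d * m)).-integrable setT (EFin \o (f \o @matrix_of_tuple R d m)).
  apply/integrableP; split.
    by apply/measurable_EFinP; exact: measurableT_comp.
  have /integrableP[_] := if_.
  rewrite /= ge0_integral_pushforward//.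
  by apply/measurable_EFinP; exact: measurableT_comp.
rewrite integral_pushforward//=.
apply: (@integral_lebesgue_tuple_coord0 _ _ (mxvec_index i j) (f \o @matrix_of_tuple R d m)) => //.
  exact: measurableT_comp.
move=> t.
have [X eX] : exists X, forall y, matrix_of_tuple (tuple_set (mxvec_index i j) t y) =
    (X + y *: delta_mx i j)%R by eexists => y; exact: matrix_of_tuple_set.
under eq_fun do rewrite /= eX.
move=> iX.
exact: (@integral_derive_vanishing _ (fun s => F (X + s *: delta_mx i j)%R)).
Qed.

End lebesgue_matrix_coord.

(** * Polynomial functions of a matrix and their partial derivatives *)

Section polyfun.
Context {R : realType} {d m : nat}.
Local Notation M := 'M[R]_(d, m).

(* Measurability, growth and continuity on lines each follow by one induction on
   this generation of the polynomial functions of the entries. *)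
Inductive polyfun : (M -> R) -> Prop :=
| polyfun_cst c : polyfun (fun=> c)
| polyfun_coord i j : polyfun (fun X => X i j)
| polyfunD f g : polyfun f -> polyfun g -> polyfun (fun X => f X + g X)
| polyfunM f g : polyfun f -> polyfun g -> polyfun (fun X => f X * g X).

Lemma eq_polyfun f g : f =1 g -> polyfun f -> polyfun g.
Proof. by move=> /funext ->. Qed.

Lemma polyfun_sum (I : Type) (r : seq I) (P : pred I) (f : I -> M -> R) :
  (forall i, polyfun (f i)) -> polyfun (fun X => \sum_(i <- r | P i) f i X).
Proof.
move=> pf; elim: r => [|a r IH].
  by apply: eq_polyfun (polyfun_cst 0) => X; rewrite big_nil.
have [Pa|Pa] := boolP (P a).
  by apply: eq_polyfun (polyfunD (pf a) IH) => X; rewrite big_cons Pa.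
by apply: eq_polyfun IH => X; rewrite big_cons (negbTE Pa).
Qed.

Lemma polyfun_prod (I : Type) (r : seq I) (P : pred I) (f : I -> M -> R) :
  (forall i, polyfun (f i)) -> polyfun (fun X => \prod_(i <- r | P i) f i X).
Proof.
move=> pf; elim: r => [|a r IH].
  by apply: eq_polyfun (polyfun_cst 1) => X; rewrite big_nil.
have [Pa|Pa] := boolP (P a).
  by apply: eq_polyfun (polyfunM (pf a) IH) => X; rewrite big_cons Pa.
by apply: eq_polyfun IH => X; rewrite big_cons (negbTE Pa).
Qed.

Definition polymx p q (A : M -> 'M[R]_(p, q)) :=
  forall k l, polyfun (fun X => A X k l).

Lemma polymx_id : polymx (fun X => X).
Proof. by move=> k l; exact: polyfun_coord. Qed.

Lemma polymx_cst p q (A : 'M[R]_(p, q)) : polymx (fun=> A).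
Proof. by move=> k l; exact: polyfun_cst. Qed.

Lemma polymx_tr p q (A : M -> 'M[R]_(p, q)) :
  polymx A -> polymx (fun X => (A X)^T).
Proof. by move=> pA k l; apply: eq_polyfun (pA l k) => X; rewrite mxE. Qed.

Lemma polymxD p q (A B : M -> 'M[R]_(p, q)) :
  polymx A -> polymx B -> polymx (fun X => A X + B X).
Proof.
by move=> pA pB k l; apply: eq_polyfun (polyfunD (pA k l) (pB k l)) => X; rewrite mxE.
Qed.

Lemma polymxZ p q (a : M -> R) (A : M -> 'M[R]_(p, q)) :
  polyfun a -> polymx A -> polymx (fun X => a X *: A X).
Proof.
by move=> pa pA k l; apply: eq_polyfun (polyfunM pa (pA k l)) => X; rewrite mxE.
Qed.

Lemma polymxM p q r (A : M -> 'M[R]_(p, q)) (B : M -> 'M[R]_(q, r)) :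
  polymx A -> polymx B -> polymx (fun X => A X *m B X).
Proof.
move=> pA pB k l; apply: eq_polyfun (polyfun_sum _ _ _) => [X|i].
  by rewrite mxE.
exact: polyfunM.
Qed.

Lemma polyfun_mxtrace n (A : M -> 'M[R]_n) :
  polymx A -> polyfun (fun X => \tr (A X)).
Proof. by move=> pA; apply: polyfun_sum => i; exact: pA. Qed.

Lemma polyfun_det n (A : M -> 'M[R]_n) :
  polymx A -> polyfun (fun X => \det (A X)).
Proof.
move=> pA; apply: polyfun_sum => s; apply: polyfunM; first exact: polyfun_cst.
by apply: polyfun_prod => i; exact: pA.
Qed.

Lemma polymx_adj n (A : M -> 'M[R]_n) : polymx A -> polymx (fun X => \adj (A X)).
Proof.
move=> pA k l; pose c X := (-1) ^+ (l + k) * \det (row' l (col' k (A X))).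
apply: (@eq_polyfun c) => [X|]; first by rewrite mxE.
apply: polyfunM; first exact: polyfun_cst.
apply: polyfun_det => i j; apply: eq_polyfun (pA (lift l i) (lift k j)) => X.
by rewrite !mxE.
Qed.

Lemma measurable_polyfun f : polyfun f -> measurable_fun setT f.
Proof.
elim=> [c|i j|g h _ mg _ mh|g h _ mg _ mh].
- exact: measurable_cst.
- exact: measurable_coord.
- exact: measurable_funD.
- exact: measurable_funM.
Qed.

(** The gauge [N] is abstract so that it can be the very function in the damping exponent, which
    then beats every polynomial. *)
Lemma polyfun_growth (N : M -> R) (c : R) f : (forall X, 0 <= N X) ->
  (forall (X : M) i j, `|X i j| <= c * (1 + N X)) -> polyfun f ->
  exists C k, forall X, `|f X| <= C * (1 + N X) ^+ k.
Proof.
move=> N0 hN.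
have mono C D k l X : C <= D -> (k <= l)%N -> 0 <= C ->
    C * (1 + N X) ^+ k <= D * (1 + N X) ^+ l.
  move=> CD kl C0; apply: ler_pM => //; first by rewrite exprn_ge0// addr_ge0.
  by apply: ler_weXn2l => //; rewrite lerDl.
elim=> [b|i j|g h _ [C [k hC]] _ [D [l hD]]|g h _ [C [k hC]] _ [D [l hD]]].
- by exists `|b|, 0%N => X; rewrite expr0 mulr1.
- by exists c, 1%N => X; rewrite expr1.
- exists (`|C| + `|D|), (maxn k l) => X.
  apply: (le_trans (ler_normD _ _)); rewrite mulrDl lerD//.
    apply: (le_trans (hC X)); apply: (@le_trans _ _ (`|C| * (1 + N X) ^+ k)).
      by rewrite ler_wpM2r ?ler_norm// exprn_ge0// addr_ge0.
    by apply: mono => //; rewrite leq_maxl.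
  apply: (le_trans (hD X)); apply: (@le_trans _ _ (`|D| * (1 + N X) ^+ l)).
    by rewrite ler_wpM2r ?ler_norm// exprn_ge0// addr_ge0.
  by apply: mono => //; rewrite leq_maxr.
- exists (C * D), (k + l)%N => X.
  by rewrite normrM exprD mulrACA ler_pM.
Qed.

Lemma continuous_polyfun_line f X E : polyfun f ->
  continuous (fun s : R => f (X + s *: E)).
Proof.
elim=> [c|i j|g h _ cg _ ch|g h _ cg _ ch].
- exact: cst_continuous.
- rewrite (_ : (fun _ => _) = (fun s : R => X i j + s * E i j)); last first.
    by apply/funext => s; rewrite !mxE.
  move=> s; apply: cvgD; first exact: cvg_cst.
  by apply: cvgMl; exact: cvg_id.
- by move=> s; apply: cvgD; [exact: cg|exact: ch].
- by move=> s; apply: cvgM; [exact: cg|exact: ch].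
Qed.

End polyfun.

(** * Differentiation in one matrix entry *)

Section partial_derivative.
Context {R : realType} {d m : nat} (i : 'I_d) (j : 'I_m).
Local Notation M := 'M[R]_(d, m).

(** The derivative is an explicit function given together with [f], and only real functions on lines
    parallel to an axis are differentiated: this is exactly what integration by parts in one entry
    consumes. *)
Definition pderiv (f f' : M -> R) := forall X (y : R),
  is_derive y (1 : R) (fun s => f (X + s *: delta_mx i j))
    (f' (X + y *: delta_mx i j)).

Definition pderivmx p q (A A' : M -> 'M[R]_(p, q)) :=
  forall k l, pderiv (fun X => A X k l) (fun X => A' X k l).

Lemma eq_pderiv f g f' g' : f =1 g -> f' =1 g' -> pderiv f f' -> pderiv g g'.
Proof. by move=> /funext -> /funext ->. Qed.

Lemma pderiv_cst c : pderiv (fun=> c) (fun=> 0).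
Proof. by move=> X y; exact: is_derive_cst. Qed.

Lemma pderiv_coord k l : pderiv (fun X => X k l) (fun=> delta_mx i j k l).
Proof.
move=> X y; rewrite (_ : (fun _ => _) = cst (X k l) + (delta_mx i j k l \*: id : R -> R)); last first.
  by apply/funext => s; rewrite !mxE mulrC.
by apply: is_derive_eq; rewrite add0r /GRing.scale/= mulr1.
Qed.

Lemma pderivD f g f' g' : pderiv f f' -> pderiv g g' ->
  pderiv (fun X => f X + g X) (fun X => f' X + g' X).
Proof. by move=> df dg X y; exact: is_deriveD. Qed.

Lemma pderivM f g f' g' : pderiv f f' -> pderiv g g' ->
  pderiv (fun X => f X * g X) (fun X => f' X * g X + f X * g' X).
Proof.
move=> df dg X y; have := is_deriveM (df X y) (dg X y).
by rewrite /GRing.scale/= addrC [g _ * _]mulrC.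
Qed.

Lemma pderiv_sum (I : Type) (r : seq I) (f f' : I -> M -> R) :
  (forall k, pderiv (f k) (f' k)) ->
  pderiv (fun X => \sum_(k <- r) f k X) (fun X => \sum_(k <- r) f' k X).
Proof.
move=> df; elim: r => [|a r IH].
  by apply: eq_pderiv (pderiv_cst 0) => X; rewrite big_nil.
by apply: eq_pderiv (pderivD (df a) IH) => X; rewrite big_cons.
Qed.

Lemma pderiv_prod (I : eqType) (r : seq I) (f f' : I -> M -> R) : uniq r ->
  (forall k, pderiv (f k) (f' k)) ->
  pderiv (fun X => \prod_(k <- r) f k X)
    (fun X => \sum_(k <- r) (f' k X * \prod_(l <- r | l != k) f l X)).
Proof.
move=> + df; elim: r => [_|a r IH /= /andP[ar ur]].
  by apply: eq_pderiv (pderiv_cst 1) => X; rewrite big_nil.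
apply: eq_pderiv (pderivM (df a) (IH ur)) => X; first by rewrite big_cons.
rewrite big_cons/= big_cons eqxx/=; congr (_ + _).
  congr (_ * _); rewrite [LHS]big_seq_cond [RHS]big_seq_cond.
  apply: eq_bigl => l; rewrite andbT.
  by case: (boolP (l \in r)) => //= lr; apply/esym/eqP => la; rewrite -la lr in ar.
rewrite mulr_sumr [LHS]big_seq [RHS]big_seq; apply: eq_bigr => k kr.
rewrite big_cons ifT; last by apply/eqP => ak; rewrite ak kr in ar.
by rewrite mulrCA.
Qed.

Lemma pderivmx_id : pderivmx (fun X => X) (fun=> delta_mx i j).
Proof. by move=> k l; exact: pderiv_coord. Qed.

Lemma pderivmx_cst p q (A : 'M[R]_(p, q)) : pderivmx (fun=> A) (fun=> 0).
Proof. by move=> k l; apply: eq_pderiv (pderiv_cst (A k l)) => X //; rewrite mxE. Qed.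

Lemma pderivmx_tr p q (A A' : M -> 'M[R]_(p, q)) : pderivmx A A' ->
  pderivmx (fun X => (A X)^T) (fun X => (A' X)^T).
Proof. by move=> dA k l; apply: eq_pderiv (dA l k) => X; rewrite mxE. Qed.

Lemma pderivmxD p q (A A' B B' : M -> 'M[R]_(p, q)) : pderivmx A A' ->
  pderivmx B B' -> pderivmx (fun X => A X + B X) (fun X => A' X + B' X).
Proof.
by move=> dA dB k l; apply: eq_pderiv (pderivD (dA k l) (dB k l)) => X; rewrite !mxE.
Qed.

Lemma pderivmxZ p q (a a' : M -> R) (A A' : M -> 'M[R]_(p, q)) : pderiv a a' ->
  pderivmx A A' ->
  pderivmx (fun X => a X *: A X) (fun X => a' X *: A X + a X *: A' X).
Proof.
by move=> da dA k l; apply: eq_pderiv (pderivM da (dA k l)) => X; rewrite !mxE.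
Qed.

Lemma pderivmxM p q r (A A' : M -> 'M[R]_(p, q)) (B B' : M -> 'M[R]_(q, r)) :
  pderivmx A A' -> pderivmx B B' ->
  pderivmx (fun X => A X *m B X) (fun X => A' X *m B X + A X *m B' X).
Proof.
move=> dA dB k l.
apply: eq_pderiv (pderiv_sum _ (fun s => pderivM (dA k s) (dB s l))) => X.
  by rewrite mxE.
by rewrite big_split !mxE.
Qed.

Lemma pderiv_mxtrace n (A A' : M -> 'M[R]_n) : pderivmx A A' ->
  pderiv (fun X => \tr (A X)) (fun X => \tr (A' X)).
Proof. by move=> dA; apply: pderiv_sum => k; exact: dA. Qed.

(** Jacobi's formula. In the Leibniz expansion the product rule replaces one row at a time by its
    derivative; expanding along the replaced row produces cofactors. With the adjugate instead of
    the inverse, the derivative remains polynomial. *)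
Lemma pderiv_det n (A A' : M -> 'M[R]_n) : pderivmx A A' ->
  pderiv (fun X => \det (A X)) (fun X => \tr (\adj (A X) *m A' X)).
Proof.
move=> dA.
have e (s : {perm 'I_n}) := pderivM (pderiv_cst ((-1) ^+ s))
  (pderiv_prod (index_enum_uniq _) (fun k => dA k (s k))).
apply: eq_pderiv (pderiv_sum _ e) => // X; rewrite mxtrace_mulC.
transitivity (\sum_k \det (\matrix_(a, b) if a == k then A' X a b else A X a b)).
  under eq_bigr do rewrite mul0r add0r mulr_sumr.
  rewrite exchange_big/=; apply: eq_bigr => k _; apply: eq_bigr => s _.
  congr (_ * _); rewrite [RHS](bigD1 k)//= mxE eqxx; congr (_ * _).
  by apply: eq_bigr => l /negbTE lk; rewrite mxE lk.
apply: eq_bigr => k _; rewrite (expand_det_row _ k) mxE; apply: eq_bigr => l _.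
rewrite !mxE eqxx; congr (_ * (_ * \det _)).
by apply/matrixP => a b; rewrite !mxE eq_sym (negbTE (neq_lift _ _)).
Qed.

End partial_derivative.

(** * Removing the damping *)

(** With [x = e * tr Q], this absorbs one power of [tr Q] in the term created by the damping. *)
Lemma mul_expRN_le1 (R : realType) (x : R) : x * expR (- x) <= 1.
Proof.
rewrite expRN ler_pdivrMr ?expR_gt0// mul1r.
by rewrite (le_trans _ (expR_ge1Dx x))// lerDr.
Qed.

Lemma exprn_expRN_bounded (R : realType) (e : R) k : 0 < e ->
  exists B, forall x, 0 <= x -> (1 + x) ^+ k * expR (- (e * x)) <= B.
Proof.
move=> e0; case: k => [|k].
  exists 1 => x x0; rewrite expr0 mul1r -expR0 ler_expR oppr_le0.
  by rewrite mulr_ge0// ltW.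
(* Chosen so that [a * (1 + x) <= 1 + (e / k.+1) * x <= expR (e * x / k.+1)]; raising to the power
   [k.+1] gives the claim. *)
pose a := Num.min 1 (e / k.+1%:R).
have a0 : 0 < a by rewrite lt_min ltr01 divr_gt0.
exists (a^-1 ^+ k.+1) => x x0.
rewrite expRN ler_pdivrMr ?expR_gt0//.
have -> : e * x = e / k.+1%:R * x * k.+1%:R by rewrite mulrAC divfK// pnatr_eq0.
rewrite expRM_natr -exprMn lerXn2r ?nnegrE ?addr_ge0//.
  by rewrite mulr_ge0 ?expR_ge0// invr_ge0 ltW.
rewrite mulrC ler_pdivlMr// mulrC.
apply: le_trans (expR_ge1Dx _).
rewrite mulrDr mulr1 lerD// ?ge_min ?lexx//.
by rewrite ler_wpM2r// ge_min lexx orbT.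
Qed.

Section damped_limit.
Local Open Scope ereal_scope.
Context d (T : measurableType d) (R : realType) (mu : {measure set T -> \bar R}).
Variables (t u v w : T -> R) (b c1 c2 : R).
Hypotheses (mt : measurable_fun setT t) (mu_ : measurable_fun setT u).
Hypothesis mv : measurable_fun setT v.
Hypotheses (t0 : forall x, (0 <= t x)%R) (u0 : forall x, (0 <= u x)%R).
Hypotheses (v0 : forall x, (0 <= v x)%R) (w0 : forall x, (0 <= w x)%R).
Hypotheses (b0 : (0 < b)%R).
Let phi e x := expR (- (e * t x)).
(** The term [e * w] tends to 0 pointwise, but [w] itself need not be integrable; this bound,
    uniform in [e], supplies the domination. *)
Hypothesis hw : forall e x, (0 < e <= 1)%R ->
  (e * w x * phi e x <= c1 * u x + c2 * v x)%R.
Let z e x := (phi e x * (u x - b * v x - e * w x))%R.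
Hypothesis iu : mu.-integrable setT (EFin \o u).
Hypothesis iz : forall e, (0 < e)%R -> mu.-integrable setT (EFin \o z e).
Hypothesis z0 : forall e, (0 < e)%R -> \int[mu]_x (z e x)%:E = 0.

Let e_ n : R := (n.+1%:R^-1)%R.

Let e_gt0 n : (0 < e_ n)%R. Proof. by rewrite invr_gt0. Qed.

Let e_le1 n : (e_ n <= 1)%R. Proof. by rewrite invf_le1// ler1n. Qed.

Let mphi e : measurable_fun setT (phi e).
Proof.
apply: measurableT_comp => //; apply: measurableT_comp => //.
exact: measurable_funM.
Qed.

Let phi_gt0 e x : (0 < phi e x)%R. Proof. exact: expR_gt0. Qed.

Let phi_le1 e x : (0 < e)%R -> (phi e x <= 1)%R.
Proof.
by move=> e0; rewrite /phi -expR0 ler_expR oppr_le0 mulr_ge0// ltW.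
Qed.

Let e_cvg0 (a : R) : (e_ n * a @[n --> \oo] --> (0 : R))%R.
Proof. by rewrite -[X in _ --> X](mul0r a); apply: cvgMl; exact: cvg_harmonic. Qed.

Let cvg_phi x : (phi (e_ n) x @[n --> \oo] --> (1 : R))%R.
Proof.
rewrite -expR0; apply: continuous_cvg; first exact: continuous_expR.
by rewrite -oppr0; apply: cvgN; exact: e_cvg0.
Qed.

(* Since [w] and [1 - phi] are nonnegative, [b * int (phi v) <= int u] for every
   damping, so monotone convergence bounds [int v]. *)
Lemma damped_limit_integrable : mu.-integrable setT (EFin \o v).
Proof.
apply/integrableP; split; first exact/measurable_EFinP.
under eq_integral do rewrite /= ger0_norm//.
have mon : \int[mu]_x (v x)%:E =
    limn (fun n => \int[mu]_x (phi (e_ n) x * v x)%:E).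
  rewrite -monotone_convergence//.
  - apply: eq_integral => x _; apply/esym/cvg_lim => //.
    apply: cvg_EFin; first by near=> n.
    rewrite -[X in _ --> X]mul1r /comp/=.
    by apply: cvgMl; exact: cvg_phi.
  - by move=> n; apply/measurable_EFinP; exact: measurable_funM.
  - by move=> n x _; rewrite lee_fin mulr_ge0// ltW.
  - move=> x _ k l kl; rewrite lee_fin ler_wpM2r// ler_expR lerN2 ler_wpM2r//.
    by rewrite lef_pV2 ?posrE// ler_nat ltnS.
have bnd n : \int[mu]_x (phi (e_ n) x * v x)%:E <= b^-1%:E * \int[mu]_x (u x)%:E.
  rewrite muleC lee_pdivlMr// -ge0_integralZr//; last 3 first.
  - by apply/measurable_EFinP; exact: measurable_funM.
  - by move=> x _; rewrite lee_fin mulr_ge0// ltW.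
  - by rewrite lee_fin ltW.
  (* Since [z] integrates to 0, [u] may be replaced by [u - z], which dominates [phi * v * b]
     pointwise. *)
  have -> : \int[mu]_x (u x)%:E = \int[mu]_x ((u x)%:E - (z (e_ n) x)%:E).
    by rewrite integralB//= ?z0// ?sube0//; exact: iz.
  apply: ge0_le_integral => //.
  - by move=> x _; rewrite mule_ge0 ?lee_fin ?mulr_ge0// ltW.
  - by apply: emeasurable_funM => //; apply/measurable_EFinP => //; exact: measurable_funM.
  - apply: emeasurable_funB; apply/measurable_EFinP => //.
    by apply/measurable_EFinP; exact: measurable_int (iz (e_gt0 n)).
  - move=> x _; rewrite -EFinM -EFinB lee_fin /z.
    have h1 := phi_le1 x (e_gt0 n); have h2 := phi_gt0 (e_ n) x.
    have h3 : (phi (e_ n) x * u x <= u x)%R by rewrite ler_piMl.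
    have h4 : (0 <= phi (e_ n) x * (e_ n * w x))%R.
      by rewrite !mulr_ge0// ltW.
    have -> : (phi (e_ n) x * (u x - b * v x - e_ n * w x) =
      phi (e_ n) x * u x - phi (e_ n) x * v x * b - phi (e_ n) x * (e_ n * w x))%R by ring.
    by move: h3 h4; set p := (phi _ _ * u x)%R; set q := (_ * (e_ n * _))%R; lra.
rewrite mon; apply: (@le_lt_trans _ _ (b^-1%:E * \int[mu]_x (u x)%:E)).
  apply: lime_le.
    apply: ereal_nondecreasing_is_cvgn => k l kl; apply: ge0_le_integral => //.
    - by move=> x _; rewrite lee_fin mulr_ge0// ltW.
    - by apply/measurable_EFinP; exact: measurable_funM.
    - by apply/measurable_EFinP; exact: measurable_funM.
    - move=> x _; rewrite lee_fin ler_wpM2r// ler_expR lerN2 ler_wpM2r//.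
      by rewrite lef_pV2 ?posrE// ler_nat ltnS.
  by near=> n; exact: bnd.
have := integrable_fin_num measurableT iu.
by move=> /fineK <-; rewrite -EFinM ltry.
Unshelve. all: by end_near. Qed.

Lemma damped_limit_integral : b%:E * \int[mu]_x (v x)%:E = \int[mu]_x (u x)%:E.
Proof.
have iv := damped_limit_integrable.
have ibv : mu.-integrable setT (fun x => b%:E * (v x)%:E) by exact: integrableZl.
(* The sum of the bounds for the three terms of [z e], the last one given by [hw]. *)
pose g x := (u x + b * v x + (c1 * u x + c2 * v x))%R.
have ig : mu.-integrable setT (EFin \o g).
  have h (p q : T -> R) (a a' : R) : mu.-integrable setT (EFin \o p) ->
     mu.-integrable setT (EFin \o q) ->
     mu.-integrable setT (EFin \o (fun x => a * p x + a' * q x)%R).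
    move=> ip iq; rewrite (_ : _ \o _ = (fun x => a%:E * (EFin \o p) x) \+ (fun x => a'%:E * (EFin \o q) x))//.
    by apply: integrableD => //; exact: integrableZl.
  rewrite (_ : g = fun x => (1 * (1 * u x + b * v x) + 1 * (c1 * u x + c2 * v x))%R); last first.
    by apply/funext => x; rewrite /g !mul1r.
  by apply: (h (fun x => 1 * u x + b * v x)%R (fun x => c1 * u x + c2 * v x)%R); exact: h.
have [|||||_ _ cv] := @dominated_convergence _ _ _ mu setT measurableT
    (fun n => EFin \o z (e_ n)) (fun x => (u x)%:E - b%:E * (v x)%:E) (EFin \o g).
- by move=> n; exact: measurable_int (iz (e_gt0 n)).
- by apply: emeasurable_funB; [exact/measurable_EFinP|exact: measurable_int ibv].
- apply: aeW => x _; rewrite -EFinM -EFinB; apply: cvg_EFin; first by near=> n.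
  rewrite -[X in _ --> X]mul1r /comp/=.
  apply: cvgM; first exact: cvg_phi.
  rewrite -[X in _ --> X]subr0; apply: cvgB; first exact: cvg_cst.
  exact: e_cvg0.
- exact: ig.
- apply: aeW => x n _; rewrite lee_fin /z.
  have h1 := phi_le1 x (e_gt0 n); have h2 := phi_gt0 (e_ n) x.
  have h3 : (phi (e_ n) x * u x <= u x)%R by rewrite ler_piMl.
  have h3' : (phi (e_ n) x * (b * v x) <= b * v x)%R by rewrite ler_piMl// mulr_ge0// ltW.
  have h4 : (e_ n * w x * phi (e_ n) x <= c1 * u x + c2 * v x)%R.
    by apply: hw; rewrite e_gt0 e_le1.
  have g1 : (0 <= phi (e_ n) x * u x)%R by rewrite mulr_ge0// ltW.
  have g2 : (0 <= phi (e_ n) x * (b * v x))%R by rewrite !mulr_ge0// ltW.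
  have g3 : (0 <= e_ n * w x * phi (e_ n) x)%R by rewrite !mulr_ge0// ltW.
  rewrite /g !mulrBr [(phi _ _ * (e_ n * _))%R]mulrC.
  move: h3 h3' h4 g1 g2 g3.
  set A := (_ * u x)%R; set B := (_ * (b * v x))%R; set D := (e_ n * w x * _)%R.
  move=> h3 h3' h4 g1 g2 g3; rewrite ler_norml; apply/andP; split; lra.
have : \int[mu]_x ((u x)%:E - b%:E * (v x)%:E) = 0.
  rewrite -[LHS](cvg_lim (@ereal_hausdorff R) cv); apply/cvg_lim => //=.
  rewrite (_ : (fun n => _) = cst 0); first exact: cvg_cst.
  by apply/funext => n; rewrite /= z0.
rewrite integralB// integralZl//.
have fu := integrable_fin_num measurableT iu; have fv := integrable_fin_num measurableT iv.
move=> /eqP; rewrite sube_eq ?add0e// ?fin_num_adde_defl ?fin_numN ?fin_numM//.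
  by move=> /eqP ->.
Unshelve. all: by end_near. Qed.

End damped_limit.

(** * The damped divergence theorem *)

Lemma normr_le1Dsqr (R : realDomainType) (x : R) : `|x| <= 1 + x ^+ 2.
Proof. by rewrite -real_normK ?num_real//; have := normr_ge0 x; nra. Qed.

Section damped_divergence.
Context {R : realType} {d m : nat}.
Local Notation M := 'M[R]_(d, m).
Variables (t D : M -> R) (a c C0 : R).
Hypotheses (pt : polyfun t) (pD : polyfun D).
Hypotheses (D1 : forall X, 1 <= D X) (t0 : forall X, 0 <= t X).
Hypotheses (a0 : 0 <= a) (c0 : 0 <= c) (C00 : 0 <= C0).
Hypothesis coord_le : forall (X : M) i j, X i j ^+ 2 <= c * t X.
Let K X := C0 * D X `^ (- a).
Hypothesis iK : (lebesgue_matrix d m).-integrable setT (EFin \o K).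

Let D0 X : 0 < D X. Proof. exact: lt_le_trans (D1 X). Qed.

Let KE X : K X = C0 * expR (- (a * ln (D X))).
Proof. by rewrite /K /powR gt_eqF// mulNr. Qed.

Let K0 X : 0 <= K X. Proof. by rewrite KE mulr_ge0// expR_ge0. Qed.

Let K_le X : K X <= C0.
Proof.
rewrite KE ler_piMr// -expR0 ler_expR oppr_le0 mulr_ge0// ln_ge0//.
Qed.

Let coord_growth (X : M) i j : `|X i j| <= (1 + c) * (1 + t X).
Proof.
apply: (le_trans (normr_le1Dsqr _)).
have := coord_le X i j; have := t0 X; move: c0; nra.
Qed.

(** The case [k = 0] bounds the integrand, the case [k = 1] makes the boundary terms decay. *)
Let poly_damped e k f : 0 < e -> polyfun f ->
  exists B, forall X, (1 + t X) ^+ k * `|f X| * expR (- (e * t X)) <= B.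
Proof.
move=> e0 /(polyfun_growth t0 coord_growth)[C [l hC]].
have [B hB] := exprn_expRN_bounded (k + l) e0.
exists (`|C| * B) => X.
apply: (@le_trans _ _ (`|C| * ((1 + t X) ^+ (k + l) * expR (- (e * t X))))); last first.
  by rewrite ler_wpM2l// hB.
rewrite mulrA ler_wpM2r ?expR_ge0// exprD mulrCA ler_wpM2l ?exprn_ge0 ?addr_ge0//.
apply: (le_trans (hC X)); rewrite ler_wpM2r ?ler_norm// exprn_ge0// addr_ge0//.
Qed.

Section field.
Variables (i : 'I_d) (j : 'I_m) (e : R) (e0 : 0 < e) (V V' t' D' : M -> R).
Hypotheses (pV : polyfun V) (pV' : polyfun V') (pt' : polyfun t') (pD' : polyfun D').
Hypotheses (dV : pderiv i j V V') (dt : pderiv i j t t') (dD : pderiv i j D D').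

(** The product [z * K] is the partial derivative of [V * expR (- (e * t)) * K], the logarithmic
    derivative of [K] being [- a * D' / D]. *)
Let z X := expR (- (e * t X)) * (V' X - e * (V X * t' X) - a * (V X * D' X / D X)).

Let pVt : polyfun (fun X => V X * t' X). Proof. exact: polyfunM. Qed.
Let pVD : polyfun (fun X => V X * D' X). Proof. exact: polyfunM. Qed.

Let mz : measurable_fun setT z.
Proof.
have -> : z = fun X => expR (- (e * t X)) *
    (V' X - e * (V X * t' X) - a * (V X * D' X * expR (- ln (D X)))).
  by apply/funext => X; rewrite (expRN (ln (D X))) lnK ?posrE.
apply: measurable_funM.
  apply: measurableT_comp => //; apply: measurableT_comp => //.
  by apply: measurable_funM => //; exact: measurable_polyfun.
apply: measurable_funB; first apply: measurable_funB.
- exact: measurable_polyfun.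
- by apply: measurable_funM => //; exact: measurable_polyfun.
- apply: measurable_funM => //; apply: measurable_funM.
    exact: measurable_polyfun.
  apply: measurableT_comp => //; apply: measurableT_comp => //.
  by apply: measurableT_comp; [exact: measurable_ln|exact: measurable_polyfun].
Qed.

Let mK : measurable_fun setT K.
Proof. by apply/measurable_EFinP; exact: measurable_int iK. Qed.

Let z_bounded : exists B, forall X, `|z X| <= B.
Proof.
have [B1 h1] := poly_damped 0 e0 pV'.
have [B2 h2] := poly_damped 0 e0 pVt.
have [B3 h3] := poly_damped 0 e0 pVD.
exists (B1 + e * B2 + a * B3) => X.
move: (h1 X) (h2 X) (h3 X); rewrite !expr0 !mul1r => {}h1 {}h2 {}h3.
rewrite normrM ger0_norm ?expR_ge0// mulrC.
have p0 : 0 <= expR (- (e * t X)) by exact: expR_ge0.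
apply: (@le_trans _ _ ((`|V' X| + e * `|V X * t' X| + a * `|V X * D' X|) *
    expR (- (e * t X)))).
  rewrite ler_wpM2r//; apply: (le_trans (ler_normB _ _)); rewrite lerD//.
    by apply: (le_trans (ler_normB _ _)); rewrite lerD// normrM gtr0_norm.
  rewrite normrM ger0_norm// ler_wpM2l// normrM ler_piMr//.
  by rewrite gtr0_norm ?invr_gt0// invf_le1.
rewrite !mulrDl -!mulrA; apply: lerD; last by rewrite ler_wpM2l.
by apply: lerD => //; rewrite ler_wpM2l// ltW.
Qed.

Let F X := V X * (C0 * expR (- (e * t X) - a * ln (D X))).

Let f X := z X * K X.

Let dF : pderiv i j F f.
Proof.
move=> X y; rewrite /F.
set Y := X + y *: delta_mx i j.
have dln : is_derive y (1 : R) (fun s => ln (D (X + s *: delta_mx i j))) ((D Y)^-1 * D' Y).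
  exact: (@is_derive1_comp _ (@ln R) (fun s => D (X + s *: delta_mx i j))
    _ _ _ (is_derive1_ln (D0 Y)) (dD X y)).
pose g s := - e * t (X + s *: delta_mx i j) + - a * ln (D (X + s *: delta_mx i j)).
have dg : is_derive y (1 : R) g (- e * t' Y + - a * ((D Y)^-1 * D' Y)).
  exact: (is_deriveD (is_deriveZ (- e) (dt X y)) (is_deriveZ (- a) dln)).
have deg := @is_derive1_comp _ (@expR R) g y _ _ (is_derive_expR (g y)) dg.
have dcg := is_deriveZ C0 deg.
have := is_deriveM (dV X y) dcg.
rewrite (_ : _ * _ = (fun s => V (X + s *: delta_mx i j) *
   (C0 * expR (- (e * t (X + s *: delta_mx i j)) - a * ln (D (X + s *: delta_mx i j)))))); last first.
  by apply/funext => s; rewrite -!mulNr.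
move=> h; apply: (is_derive_eq h).
rewrite -/Y /f /z KE /GRing.scale/= /g -/Y /GRing.scale/= !mulNr expRD.
by ring.
Qed.

Let cf X : continuous (fun s : R => f (X + s *: delta_mx i j)).
Proof.
have cl := fun h ph => @continuous_polyfun_line R d m h X (delta_mx i j) ph.
have -> : (fun s : R => f (X + s *: delta_mx i j)) = (fun s : R =>
    let Y := X + s *: delta_mx i j in
    (expR (- (e * t Y)) * (V' Y - e * (V Y * t' Y) - a * (V Y * D' Y / D Y))) *
     (C0 * expR (- (a * ln (D Y))))).
  by apply/funext => s; rewrite /f /z KE.
move=> s /=; apply: cvgM; first apply: cvgM.
- apply: continuous_cvg; first exact: continuous_expR.
  by apply: cvgN; apply: cvgMr; exact: cl.
- apply: cvgB; first apply: cvgB; first exact: cl.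
    by apply: cvgMr; exact: (cl _ pVt).
  apply: cvgMr; apply: cvgM; first exact: (cl _ pVD).
  by apply: cvgV; [rewrite gt_eqF|exact: cl].
- apply: cvgMr; apply: continuous_cvg; first exact: continuous_expR.
  apply: cvgN; apply: cvgMr; apply: continuous_cvg; first exact: continuous_ln.
  exact: cl.
Qed.

(** Moving along the line drives the entry [(i, j)], hence also [t], to infinity, so one spare power
    of [1 + t] pays for the factor [|s|]. *)
Let F_decay X : exists B, forall s, `|s| * `|F (X + s *: delta_mx i j)| <= B.
Proof.
have [B hB] := poly_damped 1 e0 pV.
pose x := X i j; exists ((`|x| + 1 + c) * (C0 * B)) => s.
set Y := X + _.
(* From [|s| <= |x| + |x + s|], [|x + s| <= 1 + (x + s)^2] and [(x + s)^2 <= c * t Y]. *)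
have hs : `|s| <= (`|x| + 1 + c) * (1 + t Y).
  have Yij : Y i j = x + s by rewrite !mxE !eqxx mulr1.
  have := coord_le Y i j; rewrite Yij => h.
  have h1 : `|s| <= `|x| + `|x + s|.
    by rewrite -{1}(addKr x s) (le_trans (ler_normD _ _))// normrN.
  have h2 := normr_le1Dsqr (x + s).
  have := t0 Y; have := normr_ge0 x; move: c0; nra.
have hF : `|F Y| <= C0 * (`|V Y| * expR (- (e * t Y))).
  rewrite /F expRD normrM [C0 * (_ * _)]mulrCA mulrC [X in _ <= X]mulrCA.
  rewrite mulrC ler_wpM2l//.
  rewrite ger0_norm; last by rewrite !mulr_ge0// expR_ge0.
  by rewrite mulrC ler_wpM2r ?expR_ge0// -KE.
apply: (le_trans (ler_pM _ _ hs hF)) => //.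
rewrite -mulrA ler_wpM2l ?addr_ge0// mulrCA ler_wpM2l//.
by have := hB Y; rewrite expr1 mulrA.
Qed.

(** The condition on [s] covers both ends of the line, [n] and [- n]. *)
Let F_cvg X (s : nat -> R) : (forall n, `|s n| = n%:R) ->
  F (X + s n *: delta_mx i j) @[n --> \oo] --> (0 : R).
Proof.
move=> hs; have [B hB] := F_decay X.
apply/norm_cvg0P; rewrite -(cvg_shiftS _).
have B0 : 0 <= B by apply: le_trans (hB 0); rewrite mulr_ge0.
apply: (@squeeze_cvgr _ _ _ _ (cst 0) (fun n => B * n.+1%:R^-1)).
- apply: nearW => n /=; rewrite normr_ge0/= ler_pdivlMr//.
  by rewrite mulrC -hs hB.
- exact: cvg_cst.
- by rewrite -[X in _ --> X](mulr0 B); apply: cvgMr; exact: cvg_harmonic.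
Qed.

Lemma damped_field_integral :
  (lebesgue_matrix d m).-integrable setT (fun X => (z X * K X)%:E) /\
  (\int[lebesgue_matrix d m]_X (z X * K X)%:E = 0)%E.
Proof.
have iz : (lebesgue_matrix d m).-integrable setT (fun X => (z X * K X)%:E).
  have [B hB] := z_bounded.
  apply: (@le_integrable _ _ _ _ _ measurableT _ (fun X => `|B|%:E * (EFin \o K) X)%E).
  - by apply/measurable_EFinP; exact: measurable_funM.
  - move=> X _; rewrite -EFinM !abse_EFin lee_fin [leLHS]normrM [leRHS]normrM.
    by rewrite normr_id ler_wpM2r// (le_trans (hB X))// ler_norm.
  - exact: integrableZl.
split => //.
apply: (@integral_partial_derivative0 _ _ _ i j F f) => //.
- exact: measurable_funM.
- by move=> X; apply: F_cvg => n; rewrite normr_nat.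
- by move=> X; apply: F_cvg => n; rewrite normrN normr_nat.
Qed.

End field.
End damped_divergence.

(** * Vector fields adapted to the density *)

Section divergence.
Context {R : realType} {d m : nat}.
Local Notation E := (fun i j => delta_mx i j : 'M[R]_(d, m)).

(** [Z i j] is the derivative of a whole field in the direction [delta_mx i j]; keeping it as a
    matrix allows the matrix product rule before any entry is extracted. *)
Definition divergence (Z : 'I_d -> 'I_m -> 'M[R]_(d, m)) : R :=
  \sum_i \sum_j Z i j i j.

Lemma divergenceD Z Z' : divergence (fun i j => Z i j + Z' i j) =
  divergence Z + divergence Z'.
Proof.
rewrite /divergence -big_split; apply: eq_bigr => i _; rewrite -big_split.
by apply: eq_bigr => j _; rewrite mxE.
Qed.

Lemma divergenceZ a Z : divergence (fun i j => a *: Z i j) = a * divergence Z.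
Proof.
rewrite /divergence mulr_sumr; apply: eq_bigr => i _; rewrite mulr_sumr.
by apply: eq_bigr => j _; rewrite mxE.
Qed.

(** This is the trace of the linear map [E |-> A *m E *m B], a Kronecker product. *)
Lemma divergence_delta (A : 'M[R]_d) (B : 'M[R]_m) :
  divergence (fun i j => A *m E i j *m B) = \tr A * \tr B.
Proof.
rewrite /divergence /mxtrace mulr_suml; apply: eq_bigr => i _.
rewrite mulr_sumr; apply: eq_bigr => j _.
rewrite -(mul_delta_mx (0 : 'I_1)) mulmxA -colE -mulmxA -rowE.
by rewrite mxE big_ord1 !mxE.
Qed.

(** The transposition crosses the indices and leaves a single trace; the [+ 1] in [d + m + 1]
    originates here. *)
Lemma divergence_deltaT (A B : 'M[R]_(d, m)) :
  divergence (fun i j => A *m (E i j)^T *m B) = \tr (A *m B^T).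
Proof.
rewrite /divergence /mxtrace; apply: eq_bigr => i _; rewrite mxE.
apply: eq_bigr => j _.
rewrite trmx_delta -(mul_delta_mx (0 : 'I_1)) mulmxA -colE -mulmxA -rowE.
by rewrite mxE big_ord1 !mxE.
Qed.

Lemma sum_mxtrace_delta (V : 'M[R]_(d, m)) (A : 'M[R]_(m, d)) :
  \sum_i \sum_j V i j * \tr (A *m E i j) = \tr (A *m V).
Proof.
rewrite [in RHS](matrix_sum_delta V) mulmx_sumr raddf_sum; apply: eq_bigr => i _.
rewrite mulmx_sumr raddf_sum; apply: eq_bigr => j _.
by rewrite -scalemxAr /= mxtraceZ.
Qed.

Lemma sum_mxtrace_deltaT (V : 'M[R]_(d, m)) (A : 'M[R]_(d, m)) :
  \sum_i \sum_j V i j * \tr (A *m (E i j)^T) = \tr (A *m V^T).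
Proof.
rewrite -mxtrace_tr trmx_mul trmxK mxtrace_mulC -sum_mxtrace_delta.
apply: eq_bigr => i _; apply: eq_bigr => j _.
by rewrite -[in LHS]mxtrace_tr trmx_mul trmxK mxtrace_mulC.
Qed.

End divergence.

Section quadratic_form_fields.
Context {R : realType} {d m : nat} (G : 'M[R]_d) (H : 'M[R]_m) (nu : R).
Local Notation M := 'M[R]_(d, m).
Implicit Type X : M.
Hypotheses (sG : G^T = G) (sH : H^T = H).
Local Notation E := (fun i j => delta_mx i j : 'M[R]_(d, m)).

(* The traces of the powers of [qform X] are those of [Delta_X Delta_X^T] when
   [G] and [H] are the inverses of the two scale matrices, but no square root
   and no change of variables is needed to differentiate them. *)
Definition qform X : 'M[R]_d := X *m H *m X^T *m G.

Definition qmom k X : R := \tr (qform X ^+ k).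

Definition qmx X : 'M[R]_d := 1%:M + nu^-1 *: (G *m X *m H *m X^T).

(** The transpose of [qmx X] for symmetric [G] and [H]; the density contains [qmx], the fields are
    multiplied by [qshift]. *)
Definition qshift X : 'M[R]_d := 1%:M + nu^-1 *: qform X.

Definition d_qform i j X : 'M[R]_d := E i j *m H *m X^T *m G + X *m H *m (E i j)^T *m G.

Definition d_qmom1 i j X : R :=
  \tr (H *m X^T *m G *m E i j) + \tr (G *m X *m H *m (E i j)^T).

Definition d_qdet i j X : R :=
  nu^-1 * (\tr (H *m X^T *m \adj (qmx X) *m G *m E i j) +
           \tr (\adj (qmx X) *m G *m X *m H *m (E i j)^T)).

Lemma polymx_qform : polymx qform.
Proof.
apply: polymxM (polymx_cst _); apply: polymxM (polymx_tr polymx_id).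
exact: polymxM polymx_id (polymx_cst _).
Qed.

Lemma polymx_qmx : polymx qmx.
Proof.
apply: polymxD (polymx_cst _) _; apply: polymxZ (polyfun_cst _) _.
apply: polymxM (polymx_tr polymx_id); apply: polymxM (polymx_cst _).
exact: polymxM (polymx_cst _) polymx_id.
Qed.

Lemma polymx_d_qform i j : polymx (d_qform i j).
Proof.
apply: polymxD; apply: polymxM (polymx_cst _).
  exact: polymxM (polymx_cst _) (polymx_tr polymx_id).
apply: polymxM (polymx_cst _); exact: polymxM polymx_id (polymx_cst _).
Qed.

Lemma polyfun_d_qmom1 i j : polyfun (d_qmom1 i j).
Proof.
apply: polyfunD; apply: polyfun_mxtrace; apply: polymxM (polymx_cst _).
  by apply: polymxM (polymx_cst _); apply: polymxM (polymx_cst _) (polymx_tr polymx_id).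
by apply: polymxM (polymx_cst _); apply: polymxM (polymx_cst _) polymx_id.
Qed.

Lemma polyfun_d_qdet i j : polyfun (d_qdet i j).
Proof.
have pA := polymx_adj polymx_qmx.
apply: polyfunM (polyfun_cst _) _.
apply: polyfunD; apply: polyfun_mxtrace; apply: polymxM (polymx_cst _).
  apply: polymxM (polymx_cst _); apply: polymxM pA.
  exact: polymxM (polymx_cst _) (polymx_tr polymx_id).
apply: polymxM (polymx_cst _); apply: polymxM polymx_id.
exact: polymxM pA (polymx_cst _).
Qed.

Lemma pderivmx_qform i j : pderivmx i j qform (d_qform i j).
Proof.
have h := pderivmxM (pderivmxM (pderivmxM (pderivmx_id i j) (pderivmx_cst i j H))
  (pderivmx_tr (pderivmx_id i j))) (pderivmx_cst i j G).
move=> k l; apply: eq_pderiv (h k l) => // X.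
by rewrite /d_qform !mulmx0 !addr0 mulmxDl.
Qed.

Lemma qmom1E X : qmom 1 X = \tr (qform X). Proof. by rewrite /qmom expr1. Qed.

Lemma pderiv_qmom1 i j : pderiv i j (qmom 1) (d_qmom1 i j).
Proof.
apply: eq_pderiv (pderiv_mxtrace (pderivmx_qform i j)) => X; first by rewrite qmom1E.
rewrite /d_qform mxtraceD /d_qmom1; congr (_ + _).
  by rewrite -!mulmxA mxtrace_mulC !mulmxA.
by rewrite mxtrace_mulC !mulmxA.
Qed.

Lemma pderiv_qdet i j : pderiv i j (fun X => \det (qmx X)) (d_qdet i j).
Proof.
have h := pderivmxM (pderivmxM (pderivmxM (pderivmx_cst i j G) (pderivmx_id i j))
  (pderivmx_cst i j H)) (pderivmx_tr (pderivmx_id i j)).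
have h' := pderivmxD (pderivmx_cst i j 1%:M) (pderivmxZ (pderiv_cst i j nu^-1) h).
apply: eq_pderiv (pderiv_det h') => X //; rewrite -/(qmx X) /d_qdet.
rewrite !mulmx0 !mul0mx !addr0 !add0r scale0r add0r -scalemxAr mxtraceZ.
congr (_ * _); rewrite mulmxDr mxtraceD; congr (_ + _); last by rewrite !mulmxA.
by rewrite !mulmxA [RHS]mxtrace_mulC !mulmxA [RHS]mxtrace_mulC !mulmxA [RHS]mxtrace_mulC !mulmxA.
Qed.

(** The bilinear form polarizing [qmom 1], so that the derivative of [qmom 1] at [X] along [U] is
    [2 * qpair X U]. *)
Definition qpair X (U : M) : R := \tr (U *m H *m X^T *m G).

Lemma qpairT X U : \tr (G *m X *m H *m U^T) = qpair X U.
Proof. by rewrite /qpair -mxtrace_tr !trmx_mul trmxK sG sH !mulmxA. Qed.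

Lemma sum_d_qmom1 X (U : M) : \sum_i \sum_j U i j * d_qmom1 i j X = 2 * qpair X U.
Proof.
under eq_bigr do under eq_bigr do rewrite mulrDr.
under eq_bigr do rewrite big_split.
rewrite big_split/= sum_mxtrace_delta sum_mxtrace_deltaT qpairT.
by rewrite mxtrace_mulC /qpair !mulmxA; ring.
Qed.

(** Both [G *m U] and [U^T] contain a factor [qmx X], which meets the adjugate and turns it into the
    determinant. Hence the logarithmic derivative of the determinant along such a field is
    polynomial. *)
Lemma sum_d_qdet X (W : M) :
  \sum_i \sum_j (qshift X *m W) i j * d_qdet i j X = 2 / nu * \det (qmx X) * qpair X W.
Proof.
set U := qshift X *m W.
have -> : \sum_i \sum_j U i j * d_qdet i j X = nu^-1 *
    (\tr (H *m X^T *m \adj (qmx X) *m G *m U) + \tr (\adj (qmx X) *m G *m X *m H *m U^T)).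
  rewrite -sum_mxtrace_delta -sum_mxtrace_deltaT -big_split/= mulr_sumr.
  apply: eq_bigr => i _; rewrite -big_split/= mulr_sumr; apply: eq_bigr => j _.
  by rewrite /d_qdet mulrCA -mulrDr.
have UT : U^T = W^T *m qmx X.
  rewrite trmx_mul; congr (_ *m _); rewrite /qshift linearD/= trmx1 linearZ/=.
  by rewrite /qform !trmx_mul trmxK sG sH !mulmxA.
have GU : G *m U = qmx X *m G *m W.
  rewrite /U mulmxA; congr (_ *m _); rewrite /qshift /qmx mulmxDr mulmx1 mulmxDl mul1mx.
  by rewrite -scalemxAr -scalemxAl /qform !mulmxA.
have -> : \tr (H *m X^T *m \adj (qmx X) *m G *m U) = \det (qmx X) * qpair X W.
  rewrite -[_ *m G *m U]mulmxA GU !mulmxA -[_ *m \adj _ *m _]mulmxA mul_adj_mx.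
  rewrite mul_mx_scalar -!scalemxAl mxtraceZ; congr (_ * _).
  by rewrite mxtrace_mulC /qpair !mulmxA.
have -> : \tr (\adj (qmx X) *m G *m X *m H *m U^T) = \det (qmx X) * qpair X W.
  rewrite UT !mulmxA mxtrace_mulC !mulmxA mul_mx_adj.
  by rewrite -!mulmxA mul_scalar_mx mxtraceZ !mulmxA qpairT.
ring.
Qed.

Lemma qmom2E X : qmom 2 X = \tr (qform X *m qform X).
Proof. by rewrite /qmom expr2. Qed.

Lemma qmom3E X : qmom 3 X = \tr (qform X *m qform X *m qform X).
Proof. by rewrite /qmom exprS expr2 mulrA. Qed.

Lemma qpairMl X (A : 'M[R]_d) : qpair X (A *m X) = \tr (A *m qform X).
Proof. by rewrite /qpair /qform !mulmxA. Qed.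

Lemma qpair_id X : qpair X X = qmom 1 X.
Proof. by rewrite qmom1E. Qed.

Lemma qpairD X (U W : M) : qpair X (U + W) = qpair X U + qpair X W.
Proof. by rewrite /qpair !mulmxDl mxtraceD. Qed.

Lemma qpairZ X a (U : M) : qpair X (a *: U) = a * qpair X U.
Proof. by rewrite /qpair -!scalemxAl mxtraceZ. Qed.

Lemma mxtrace_qshift X : \tr (qshift X) = d%:R + nu^-1 * qmom 1 X.
Proof. by rewrite /qshift mxtraceD mxtraceZ mxtrace1 qmom1E. Qed.

Lemma mxtrace_qshiftM X (A : 'M[R]_d) :
  \tr (qshift X *m A) = \tr A + nu^-1 * \tr (qform X *m A).
Proof. by rewrite /qshift mulmxDl mul1mx -scalemxAl mxtraceD mxtraceZ. Qed.

Lemma divergence_d_qform X (A : 'M[R]_d) (B : M) :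
  divergence (fun i j => A *m d_qform i j X *m B) =
  \tr A * qpair X B + \tr (A *m X *m H *m B^T *m G).
Proof.
have -> : (fun i j => A *m d_qform i j X *m B) = (fun i j =>
    A *m E i j *m (H *m X^T *m G *m B) + (A *m X *m H) *m (E i j)^T *m (G *m B)).
  by apply/funext => i; apply/funext => j; rewrite /d_qform mulmxDr mulmxDl !mulmxA.
rewrite divergenceD divergence_delta divergence_deltaT; congr (_ * _ + _).
  by rewrite mxtrace_mulC /qpair !mulmxA.
by rewrite trmx_mul sG !mulmxA.
Qed.

Lemma divergence_mull (A : 'M[R]_d) :
  divergence (fun i j => A *m E i j) = \tr A * m%:R.
Proof.
rewrite -(mxtrace1 R m) -divergence_delta; congr divergence.
by apply/funext => i; apply/funext => j; rewrite mulmx1.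
Qed.

Definition field1 X : M := qshift X *m X.

(** The factor [1%:M] gives the first term the shape expected by [divergence_d_qform]. *)
Definition d_field1 i j X : M :=
  nu^-1 *: (1%:M *m d_qform i j X *m X) + qshift X *m E i j.

(* The weight [nu - 2] makes the terms in [qmom 1 X ^+ 2] cancel between the
   divergence of [field2] and the logarithmic derivative of the density. *)
Definition dir2 X : M := (nu - 2) *: (qform X *m X) + qmom 1 X *: X.

Definition field2 X : M := qshift X *m dir2 X.

Definition d_field2 i j X : M :=
  nu^-1 *: (1%:M *m d_qform i j X *m dir2 X) +
  ((nu - 2) *: (qshift X *m d_qform i j X *m X) +
   (nu - 2) *: ((qshift X *m qform X) *m E i j) +
   (d_qmom1 i j X *: field1 X + qmom 1 X *: (qshift X *m E i j))).

Lemma divergence_field1 X : divergence (fun i j => d_field1 i j X) =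
  d%:R * m%:R + nu^-1 * (d%:R + m%:R + 1) * qmom 1 X.
Proof.
rewrite /d_field1 divergenceD divergenceZ divergence_d_qform divergence_mull.
rewrite mul1mx mxtrace1 mxtrace_qshift qpair_id.
by rewrite -[X in \tr X]/(qform X) -qmom1E; ring.
Qed.

Lemma qpair_dir2 X : qpair X (dir2 X) = (nu - 2) * qmom 2 X + qmom 1 X ^+ 2.
Proof. by rewrite /dir2 qpairD !qpairZ qpairMl qpair_id qmom2E expr2. Qed.

Lemma qpair_field1 X : qpair X (field1 X) = qmom 1 X + nu^-1 * qmom 2 X.
Proof. by rewrite /field1 qpairMl mxtrace_qshiftM qmom1E qmom2E. Qed.

Lemma qpair_field2 X : qpair X (field2 X) =
  (nu - 2) * (qmom 2 X + nu^-1 * qmom 3 X) +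
  qmom 1 X * (qmom 1 X + nu^-1 * qmom 2 X).
Proof.
rewrite /field2 /dir2 mulmxDr -!scalemxAr -/(field1 X) qpairD !qpairZ qpair_field1.
by rewrite mulmxA qpairMl -mulmxA mxtrace_qshiftM mulmxA qmom2E qmom3E.
Qed.

Lemma divergence_field2 X : divergence (fun i j => d_field2 i j X) =
  nu^-1 * (d%:R + 1) * ((nu - 2) * qmom 2 X + qmom 1 X ^+ 2) +
  (nu - 2) * ((d%:R + nu^-1 * qmom 1 X) * qmom 1 X +
              (1 + m%:R) * (qmom 1 X + nu^-1 * qmom 2 X)) +
  2 * (qmom 1 X + nu^-1 * qmom 2 X) +
  qmom 1 X * ((d%:R + nu^-1 * qmom 1 X) * m%:R).
Proof.
rewrite /d_field2 !divergenceD !divergenceZ !divergence_d_qform !divergence_mull.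
have -> : divergence (fun i j => d_qmom1 i j X *: field1 X) =
    2 * (qmom 1 X + nu^-1 * qmom 2 X).
  rewrite -qpair_field1 -sum_d_qmom1; apply: eq_bigr => i _; apply: eq_bigr => j _.
  by rewrite mxE mulrC.
have -> : \tr (1%:M *m X *m H *m (dir2 X)^T *m G) = qpair X (dir2 X).
  by rewrite mul1mx mxtrace_mulC !mulmxA qpairT.
have -> : \tr (qshift X *m X *m H *m X^T *m G) = qmom 1 X + nu^-1 * qmom 2 X.
  by rewrite -qpair_field1 /qpair /field1.
have -> : \tr (qshift X *m qform X) = qmom 1 X + nu^-1 * qmom 2 X.
  by rewrite -qpair_field1 /field1 qpairMl.
rewrite qpair_dir2 qpair_id mxtrace1 mxtrace_qshift; ring.
Qed.

Lemma polymx_qshift : polymx qshift.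
Proof. exact: polymxD (polymx_cst _) (polymxZ (polyfun_cst _) polymx_qform). Qed.

Lemma polyfun_qmom k : polyfun (qmom k).
Proof.
apply: polyfun_mxtrace; elim: k => [|k IH].
  have -> : (fun X => qform X ^+ 0) = fun=> 1%:M by [].
  exact: polymx_cst.
have -> : (fun X => qform X ^+ k.+1) = fun X => qform X *m qform X ^+ k.
  by apply/funext => X; rewrite exprS.
exact: polymxM polymx_qform IH.
Qed.

Lemma polymx_field1 : polymx field1.
Proof. exact: polymxM polymx_qshift polymx_id. Qed.

Lemma polymx_dir2 : polymx dir2.
Proof.
apply: polymxD; apply: polymxZ.
- exact: polyfun_cst.
- exact: polymxM polymx_qform polymx_id.
- exact: polyfun_qmom.
- exact: polymx_id.
Qed.

Lemma polymx_field2 : polymx field2.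
Proof. exact: polymxM polymx_qshift polymx_dir2. Qed.

Lemma polymx_d_field1 i j : polymx (d_field1 i j).
Proof.
apply: polymxD.
  apply: polymxZ (polyfun_cst _) _; apply: polymxM polymx_id.
  exact: polymxM (polymx_cst _) (polymx_d_qform i j).
exact: polymxM polymx_qshift (polymx_cst _).
Qed.

Lemma polymx_d_field2 i j : polymx (d_field2 i j).
Proof.
have pE := polymxM polymx_qshift (polymx_cst (E i j)).
apply: polymxD.
  apply: polymxZ (polyfun_cst _) _; apply: polymxM polymx_dir2.
  exact: polymxM (polymx_cst _) (polymx_d_qform i j).
apply: polymxD; apply: polymxD.
- apply: polymxZ (polyfun_cst _) _; apply: polymxM polymx_id.
  exact: polymxM polymx_qshift (polymx_d_qform i j).
- apply: polymxZ (polyfun_cst _) _; apply: polymxM (polymx_cst _).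
  exact: polymxM polymx_qshift polymx_qform.
- exact: polymxZ (polyfun_d_qmom1 i j) polymx_field1.
- exact: polymxZ (polyfun_qmom 1) pE.
Qed.

Lemma pderivmx_qshift i j : pderivmx i j qshift (fun X => nu^-1 *: d_qform i j X).
Proof.
have h := pderivmxD (pderivmx_cst i j 1%:M)
  (pderivmxZ (pderiv_cst i j nu^-1) (pderivmx_qform i j)).
by move=> k l; apply: eq_pderiv (h k l) => // X; rewrite scale0r !add0r.
Qed.

Lemma pderivmx_field1 i j : pderivmx i j field1 (d_field1 i j).
Proof.
have h := pderivmxM (pderivmx_qshift i j) (pderivmx_id i j).
by move=> k l; apply: eq_pderiv (h k l) => // X; rewrite /d_field1 mul1mx scalemxAl.
Qed.

Lemma pderivmx_field2 i j : pderivmx i j field2 (d_field2 i j).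
Proof.
have h2 := pderivmxD (pderivmxZ (pderiv_cst i j (nu - 2))
    (pderivmxM (pderivmx_qform i j) (pderivmx_id i j)))
  (pderivmxZ (pderiv_qmom1 i j) (pderivmx_id i j)).
have h := pderivmxM (pderivmx_qshift i j) h2.
move=> k l; apply: eq_pderiv (h k l) => // X; congr (fun_of_matrix _ _ _).
rewrite /d_field2 mul1mx -/(dir2 X) -scalemxAl scale0r add0r; congr (_ + _).
rewrite [LHS]mulmxDr; congr (_ + _); last by rewrite [LHS]mulmxDr -!scalemxAr.
by rewrite -scalemxAr -scalerDr; congr (_ *: _); rewrite [LHS]mulmxDr !mulmxA.
Qed.

End quadratic_form_fields.

(** * The quadratic form in terms of the standardized matrix *)

Section standardized.
Context {R : realType} {d m : nat} (Sigma : 'M[R]_d) (Omega : 'M[R]_m).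
Hypotheses (pS : posdefmx Sigma) (pO : posdefmx Omega).
Local Notation G := (invmx Sigma).
Local Notation H := (invmx Omega).
Local Notation sqS := (sqrtmx Sigma).
Local Notation sqO := (sqrtmx Omega).
Local Notation Delta := (standardize Sigma Omega).
Implicit Type X : 'M[R]_(d, m).

Lemma invmx_posdef_sym n (A : 'M[R]_n) : posdefmx A -> (invmx A)^T = invmx A.
Proof. by move=> [sA _]; rewrite trmx_inv sA. Qed.

Lemma sqrtmx_unit n (A : 'M[R]_n) : posdefmx A -> sqrtmx A \in unitmx.
Proof. by move=> /posdefmx_sqrtmx[/posdefmx_unit]. Qed.

Lemma invmx_sqrtmx n (A : 'M[R]_n) : posdefmx A ->
  invmx A = invmx (sqrtmx A) *m invmx (sqrtmx A).
Proof.
move=> pA; have u := sqrtmx_unit pA; have [_ e] := posdefmx_sqrtmx pA.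
have ee : A *m (invmx (sqrtmx A) *m invmx (sqrtmx A)) = 1%:M.
  by rewrite -{1}e mulmxA mulmxK// mulmxV.
by rewrite -[LHS]mulmx1 -ee mulKmx// posdefmx_unit.
Qed.

Lemma standardize_gram X :
  Delta X *m (Delta X)^T = invmx sqS *m (X *m H *m X^T) *m invmx sqS.
Proof.
have [p1 _] := posdefmx_sqrtmx pS; have [p2 _] := posdefmx_sqrtmx pO.
rewrite /standardize !trmx_mul !invmx_posdef_sym// (invmx_sqrtmx pO) !mulmxA //.
Qed.

Lemma standardizeK X : sqS *m Delta X *m sqO = X.
Proof.
rewrite /standardize !mulmxA mulmxV ?sqrtmx_unit// mul1mx -mulmxA mulVmx ?sqrtmx_unit//.
by rewrite mulmx1.
Qed.

(** The Gram matrix of [Delta X] and [qform G H X] are conjugate by the square root of [Sigma],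
    hence so are their powers. *)
Lemma mxtrace_standardize_gramX k X :
  \tr ((Delta X *m (Delta X)^T) ^+ k) = qmom G H k X.
Proof.
set B := Delta X *m _; set A := qform G H X; set s := invmx sqS.
have us := sqrtmx_unit pS.
have e : B *m s = s *m A.
  by rewrite /B standardize_gram /A /qform (invmx_sqrtmx pS) !mulmxA.
have ek : B ^+ k *m s = s *m A ^+ k.
  elim: k => [|k IH]; first by rewrite !expr0 mul1mx mulmx1.
  by rewrite exprSr -[_ *m s]mulmxA e mulmxA IH -mulmxA [in RHS]exprSr.
have -> : B ^+ k = s *m A ^+ k *m sqS by rewrite -ek mulmxKV.
by rewrite mxtrace_mulC mulmxA mulmxV// mul1mx.
Qed.

(** Conjugation by the square root of [Sigma] turns [qmx] into 1 plus the Gram matrix of [Delta X]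
    scaled by the square root of [nu^-1]. *)
Lemma det_qmx_ge1 nu X : 0 <= nu -> 1 <= \det (qmx G H nu X).
Proof.
move=> nu0; have us := sqrtmx_unit pS.
have -> : \det (qmx G H nu X) = \det (1%:M + nu^-1 *: (Delta X *m (Delta X)^T)).
  have -> : 1%:M + nu^-1 *: (Delta X *m (Delta X)^T) =
      sqS *m qmx G H nu X *m invmx sqS.
    rewrite /qmx mulmxDr mulmx1 mulmxDl mulmxV//; congr (_ + _).
    rewrite standardize_gram -scalemxAr -scalemxAl (invmx_sqrtmx pS) !mulmxA.
    by rewrite mulmxV// mul1mx.
  by rewrite !det_mulmx det_inv mulrAC mulrV ?mul1r// -unitmxE.
have -> : nu^-1 *: (Delta X *m (Delta X)^T) =
    (Num.sqrt nu^-1 *: Delta X) *m (Num.sqrt nu^-1 *: Delta X)^T.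
  by rewrite linearZ/= -scalemxAr -scalemxAl scalerA -expr2 sqr_sqrtr// invr_ge0.
exact: det1D_gram_ge1.
Qed.

Lemma qmom1_gram X : qmom G H 1 X = \tr (Delta X *m (Delta X)^T).
Proof. by rewrite -mxtrace_standardize_gramX expr1. Qed.

Let gram_sym X : (Delta X *m (Delta X)^T)^T = Delta X *m (Delta X)^T.
Proof. by rewrite trmx_mul trmxK. Qed.

Lemma qmom2_gram X : qmom G H 2 X =
  \tr (Delta X *m (Delta X)^T *m (Delta X *m (Delta X)^T)^T).
Proof. by rewrite -mxtrace_standardize_gramX expr2 gram_sym. Qed.

(** An odd power of the Gram matrix is again a Gram matrix, that of the product with one more
    [Delta X]; positivity and the bound by lower moments follow. *)
Lemma qmom3_gram X : qmom G H 3 X =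
  \tr (Delta X *m (Delta X)^T *m Delta X *m (Delta X *m (Delta X)^T *m Delta X)^T).
Proof.
have -> : (Delta X *m (Delta X)^T *m Delta X)^T =
    (Delta X)^T *m (Delta X *m (Delta X)^T) by rewrite [LHS]trmx_mul gram_sym.
rewrite -mxtrace_standardize_gramX exprS expr2; congr (\tr _).
by rewrite -[RHS]mulmxA [Delta X *m (_ *m _)]mulmxA.
Qed.

Lemma qmom1_ge0 X : 0 <= qmom G H 1 X.
Proof. by rewrite qmom1_gram mxtrace_gram_ge0. Qed.

Lemma qmom2_ge0 X : 0 <= qmom G H 2 X.
Proof. by rewrite qmom2_gram mxtrace_gram_ge0. Qed.

Lemma qmom3_ge0 X : 0 <= qmom G H 3 X.
Proof. by rewrite qmom3_gram mxtrace_gram_ge0. Qed.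

Lemma qmom2_le X : qmom G H 2 X <= qmom G H 1 X ^+ 2.
Proof.
rewrite qmom2_gram qmom1_gram (le_trans (mxtrace_gramM_le _ _))// trmxK.
by rewrite [\tr ((Delta X)^T *m _)]mxtrace_mulC expr2.
Qed.

Lemma qmom3_le X : qmom G H 3 X <= qmom G H 1 X * qmom G H 2 X.
Proof.
rewrite qmom3_gram qmom1_gram qmom2_gram (le_trans (mxtrace_gramM_le _ _))//.
by rewrite mulrC.
Qed.

(** Coercivity of [tr Q], from [X = sqS *m Delta X *m sqO]: damping in [tr Q] controls every entry
    of [X]. *)
Lemma coord_le_qmom1 : exists2 c, 0 <= c &
  forall X i j, X i j ^+ 2 <= c * qmom G H 1 X.
Proof.
exists (\tr (sqS *m sqS^T) * \tr (sqO *m sqO^T)).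
  by rewrite mulr_ge0 ?mxtrace_gram_ge0.
move=> X i j; rewrite (le_trans (coord_le_mxtrace_gram X i j))//.
rewrite -{1 2}(standardizeK X) (le_trans (mxtrace_gramM_le _ _))//.
rewrite qmom1_gram mulrAC ler_wpM2r ?mxtrace_gram_ge0//.
exact: mxtrace_gramM_le.
Qed.

End standardized.

(** * Moments of the matrix-variate T distribution *)

Section matrix_T_moments.
Context {R : realType} {d m : nat} (Sigma : 'M[R]_d) (Omega : 'M[R]_m) (nu : R).
Hypotheses (pS : posdefmx Sigma) (pO : posdefmx Omega) (nu0 : 0 < nu).
Context {disp : measure_display} {W : measurableType disp} (P : probability W R).
Variable X : {RV P >-> 'M[R]_(d, m)}.
Hypothesis TX : matrix_T_distributed X nu Sigma Omega.
Local Notation M := 'M[R]_(d, m).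
Local Notation G := (invmx Sigma).
Local Notation H := (invmx Omega).
Local Notation K := (matrix_T_density nu Sigma Omega).
Local Notation t1 := (qmom G H 1).
Local Notation t2 := (qmom G H 2).
Local Notation t3 := (qmom G H 3).
Let a := (nu + m%:R + d%:R - 1) / 2.
Let D (x : M) := \det (qmx G H nu x).

Let sG : G^T = G. Proof. exact: invmx_posdef_sym. Qed.
Let sH : H^T = H. Proof. exact: invmx_posdef_sym. Qed.

Lemma multi_Gamma_ge0 k (x : R) : 0 <= multi_Gamma k x.
Proof.
rewrite mulr_ge0 ?powR_ge0//; apply: prodr_ge0 => j _.
by apply: Rintegral_ge0 => t _; rewrite mulr_ge0 ?powR_ge0 ?expR_ge0.
Qed.

Let C0 : R := multi_Gamma d a / multi_Gamma d ((nu + d%:R - 1) / 2) /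
  ((nu * pi) `^ ((m * d)%N%:R / 2) * \det Sigma `^ (m%:R / 2) * \det Omega `^ (d%:R / 2)).

Let KE x : K x = C0 * D x `^ (- a).
Proof. by rewrite /matrix_T_density /C0 -/a mulrA mulrAC. Qed.

Let C00 : 0 <= C0.
Proof. by rewrite !divr_ge0 ?multi_Gamma_ge0 ?mulr_ge0 ?powR_ge0. Qed.

Let K0 x : 0 <= K x.
Proof. by rewrite KE mulr_ge0 ?powR_ge0. Qed.

Let mK : measurable_fun setT K.
Proof.
rewrite (_ : K = fun x => C0 * D x `^ (- a)); last by apply/funext => x; exact: KE.
apply: measurable_funM => //; apply: (measurableT_comp (measurable_powR _)).
by apply: measurable_polyfun; apply: polyfun_det; exact: polymx_qmx.
Qed.

Let iK : (lebesgue_matrix d m).-integrable setT (EFin \o K).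
Proof.
apply/integrableP; split; first exact/measurable_EFinP.
have := TX measurableT; rewrite probability_setT => e.
by under eq_integral do rewrite /= ger0_norm//; rewrite -e ltry.
Qed.

Let TXE A : measurable A -> distribution P X A =
  (\int[lebesgue_matrix d m]_(x in A) (K x)%:E)%E.
Proof. exact: TX. Qed.

Let a0 : (0 < d)%N -> 0 <= a.
Proof.
move=> d0; rewrite divr_ge0//.
have : 1 <= d%:R :> R by rewrite ler1n.
by have : 0 <= m%:R :> R by []; move: nu0; lra.
Qed.

(** The entrywise identities are summed over [(i, j)] and multiplied by [nu] to clear denominators.
    The coefficient of [qpair G H x (U x)] is then [nu * a * (2 / nu) = 2 * a]. *)
Lemma damped_divergence_theorem (V U : M -> M) (dV : 'I_d -> 'I_m -> M -> M) e :
  (0 < d)%N -> 0 < e -> polymx V -> (forall i j, polymx (dV i j)) ->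
  (forall i j, pderivmx i j V (dV i j)) ->
  (forall x, V x = qshift G H nu x *m U x) ->
  let z x := expR (- (e * t1 x)) * (nu * divergence (fun i j => dV i j x)
    - (nu + m%:R + d%:R - 1) * qpair G H x (U x) - e * (2 * nu * qpair G H x (V x))) in
  measurable_fun setT z ->
  (distribution P X).-integrable setT (EFin \o z) /\
  (\int[distribution P X]_x (z x)%:E = 0)%E.
Proof.
move=> d0 e0 pV pdV hV VU z mz.
have [c c0 hc] := coord_le_qmom1 pS pO.
pose zz (p : 'I_d * 'I_m) x := expR (- (e * t1 x)) *
  (dV p.1 p.2 x p.1 p.2 - e * (V x p.1 p.2 * d_qmom1 G H p.1 p.2 x)
   - a * (V x p.1 p.2 * d_qdet G H nu p.1 p.2 x / D x)).
have hz p : (lebesgue_matrix d m).-integrable setT (fun x => (zz p x * K x)%:E) /\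
    (\int[lebesgue_matrix d m]_x (zz p x * K x)%:E = 0)%E.
  have eK : K = fun x => C0 * D x `^ (- a) by apply/funext => x; exact: KE.
  rewrite eK.
  apply: (@damped_field_integral _ _ _ t1 D a c C0 _ _ _ _ _ _ _ _ _ p.1 p.2 e e0
    (fun x => V x p.1 p.2) (fun x => dV p.1 p.2 x p.1 p.2)) => //.
  - exact: polyfun_qmom.
  - by apply: polyfun_det; exact: polymx_qmx.
  - by move=> x; apply: det_qmx_ge1 => //; exact: ltW.
  - exact: qmom1_ge0.
  - exact: a0.
  - by rewrite -eK.
  - exact: pdV.
  - exact: polyfun_d_qmom1.
  - exact: polyfun_d_qdet.
  - exact: hV.
  - exact: pderiv_qmom1.
  - exact: pderiv_qdet.
have zE x : z x = nu * \sum_p zz p x.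
  have D0 : D x != 0 by rewrite gt_eqF// (lt_le_trans ltr01)// det_qmx_ge1// ltW.
  rewrite -mulr_sumr mulrCA /z; congr (_ * _).
  rewrite !sumrB -!mulr_sumr -mulr_suml.
  rewrite -(pair_bigA _ (fun i j => dV i j x i j))/= -/(divergence _).
  rewrite -(pair_bigA _ (fun i j => V x i j * d_qmom1 G H i j x))/= sum_d_qmom1//.
  rewrite -(pair_bigA _ (fun i j => V x i j * d_qdet G H nu i j x))/=.
  rewrite [in X in _ - _ * (X / _)]VU sum_d_qdet// -/(D x) /a.
  by field; rewrite D0 gt_eqF.
have izz : (lebesgue_matrix d m).-integrable setT
    (fun x => (\sum_p (zz p x * K x)%:E)%E).
  by apply: integrable_sum => // p _; exact: (hz p).1.
have zKE x : (z x * K x)%:E = (nu%:E * \sum_p (zz p x * K x)%:E)%E.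
  by rewrite zE sumEFin -EFinM -mulrA mulr_suml.
split.
  apply: (integrable_density mK K0 TXE) => //.
  under eq_fun do rewrite zKE.
  exact: integrableZl.
rewrite (integral_density mK K0 TXE)//.
under eq_integral do rewrite zKE.
rewrite integralZl// integral_sum//; last by move=> p; exact: (hz p).1.
by rewrite big1 ?mule0// => p _; exact: (hz p).2.
Qed.

Let mt k : measurable_fun setT (qmom G H k : M -> R).
Proof. by apply: measurable_polyfun; exact: polyfun_qmom. Qed.

Lemma qmom1_moment : (0 < d)%N -> 2 < nu ->
  (distribution P X).-integrable setT (EFin \o t1) /\
  ((nu - 2)%:E * \int[distribution P X]_x (t1 x)%:E = (nu * (d%:R * m%:R))%:E)%E.
Proof.
move=> d0 nu2.
pose u : M -> R := cst (nu * (d%:R * m%:R)).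
pose w (x : M) := 2 * (nu * t1 x + t2 x).
have mw : measurable_fun setT w.
  apply: measurable_funM => //; apply: measurable_funD => //.
  exact: measurable_funM.
pose z e x := expR (- (e * t1 x)) * (u x - (nu - 2) * t1 x - e * w x).
have zE e : z e = fun x =>
    expR (- (e * t1 x)) * (nu * divergence (fun i j => d_field1 G H nu i j x)
    - (nu + m%:R + d%:R - 1) * qpair G H x x
    - e * (2 * nu * qpair G H x (field1 G H nu x))).
  apply/funext => x; congr (_ * _).
  (* The coefficient of [t1] is [(d + m + 1) - (nu + m + d - 1) = - (nu - 2)]. *)
  rewrite divergence_field1// qpair_id qpair_field1 /u/w/=.
  by field; rewrite gt_eqF.
have iz e : 0 < e -> (distribution P X).-integrable setT (EFin \o z e) /\
    (\int[distribution P X]_x (z e x)%:E = 0)%E.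
  move=> e0; have mz : measurable_fun setT (z e).
    apply: measurable_funM.
      by apply: measurableT_comp => //; apply: measurableT_comp => //; exact: measurable_funM.
    apply: measurable_funB; last exact: measurable_funM.
    by apply: measurable_funB => //; exact: measurable_funM.
  rewrite zE in mz *.
  apply: (@damped_divergence_theorem (field1 G H nu) id (d_field1 G H nu)) => //.
  - exact: polymx_field1.
  - exact: polymx_d_field1.
  - exact: pderivmx_field1.
have u0 x : 0 <= u x by rewrite /u/= !mulr_ge0// ltW.
have w0 x : 0 <= w x.
  by rewrite !mulr_ge0// addr_ge0 ?qmom2_ge0// mulr_ge0 ?qmom1_ge0// ltW.
(* The part [nu * t1] of [w] uses [e * p <= 1]; the part [t2] uses [t2 <= t1 ^+ 2] and
   [e * t1 * p <= 1], with [p] the damping factor. *)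
have hw e x : 0 < e <= 1 -> e * w x * expR (- (e * t1 x)) <= 0 * u x + (2 * nu + 2) * t1 x.
  move=> /andP[e0 e1]; rewrite mul0r add0r.
  have := mul_expRN_le1 (e * t1 x).
  have p0 := expR_gt0 (- (e * t1 x)).
  have p1 : expR (- (e * t1 x)) <= 1.
    by rewrite -expR0 ler_expR oppr_le0 mulr_ge0 ?qmom1_ge0// ltW.
  have := qmom1_ge0 pS pO x; have := qmom2_ge0 pS pO x; have := qmom2_le pS pO x.
  move: (expR _) p0 p1 => p p0 p1; rewrite /w.
  move: (t1 x) (t2 x) => x1 x2 h1 h2 h3 h4.
  have q1 : e * p * x1 <= x1 by rewrite ler_piMl// mulr_ile1// ltW.
  have q2 : e * p * x2 <= x1.
    apply: (@le_trans _ _ (e * p * x1 ^+ 2)); first by rewrite ler_wpM2l// mulr_ge0// ltW.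
    by rewrite (_ : _ * _ = (e * x1 * p) * x1) ?ler_piMl//; ring.
  rewrite (_ : _ * _ * p = 2 * (nu * (e * p * x1) + e * p * x2)); last by ring.
  rewrite (_ : (2 * nu + 2) * x1 = 2 * (nu * x1 + x1)); last by ring.
  by rewrite ler_wpM2l// lerD// ler_wpM2l// ltW.
have iu : (distribution P X).-integrable setT (EFin \o u).
  exact: finite_measure_integrable_cst.
have b0 : 0 < nu - 2 by rewrite subr_gt0.
split.
  apply: (@damped_limit_integrable _ _ _ _ t1 u t1 w (nu - 2)) => //.
  - exact: qmom1_ge0.
  - exact: qmom1_ge0.
  - by move=> e /iz[].
  - by move=> e /iz[].
rewrite (@damped_limit_integral _ _ _ _ t1 u t1 w (nu - 2) 0 (2 * nu + 2))//.
- apply: (etrans (integral_cst _ measurableT (nu * (d%:R * m%:R))%:E)).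
  by rewrite -[RHS]mule1; congr (_ * _)%E; exact: (probability_setT (distribution P X)).
- exact: qmom1_ge0.
- exact: qmom1_ge0.
- by move=> e /iz[].
- by move=> e /iz[].
Qed.

Lemma qmom2_moment : (0 < d)%N -> 4 < nu ->
  (((nu - 1) * (nu - 4))%:E * \int[distribution P X]_x (t2 x)%:E =
   (nu * ((d%:R + m%:R) * (nu - 2) + nu + d%:R * m%:R))%:E *
     \int[distribution P X]_x (t1 x)%:E)%E.
Proof.
move=> d0 nu4; have nu2 : 2 < nu by lra.
have [it1 _] := qmom1_moment d0 nu2.
set c := (d%:R + m%:R) * (nu - 2) + nu + d%:R * m%:R.
have c0 : 0 < c.
  have nu2' : 0 <= nu - 2 by lra.
  have e1 : 0 <= (d%:R + m%:R) * (nu - 2) by apply: mulr_ge0 => //; exact: addr_ge0.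
  have e2 : 0 <= d%:R * m%:R :> R by rewrite mulr_ge0.
  by rewrite /c; lra.
pose u (x : M) := nu * c * t1 x.
pose b := (nu - 1) * (nu - 4).
pose w (x : M) := 2 * ((nu - 2) * (nu * t2 x + t3 x) + nu * t1 x ^+ 2 + t1 x * t2 x).
have mu : measurable_fun setT u by exact: measurable_funM.
have mw : measurable_fun setT w.
  apply: measurable_funM => //; apply: measurable_funD; last exact: measurable_funM.
  apply: measurable_funD; apply: measurable_funM => //; last exact: measurable_funX.
  by apply: measurable_funD => //; exact: measurable_funM.
pose z e x := expR (- (e * t1 x)) * (u x - b * t2 x - e * w x).
have zE e : z e = fun x =>
    expR (- (e * t1 x)) * (nu * divergence (fun i j => d_field2 G H nu i j x)
    - (nu + m%:R + d%:R - 1) * qpair G H x (dir2 G H nu x)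
    - e * (2 * nu * qpair G H x (field2 G H nu x))).
  apply/funext => x; congr (_ * _).
  (* The coefficient of [t2] is [(nu - 2) * (d + m + 2) + 2 - (nu - 2) * (nu + m + d - 1)], that is
     [(nu - 2) * (3 - nu) + 2 = - (nu - 1) * (nu - 4)]. *)
  rewrite divergence_field2// qpair_dir2 qpair_field2 /u/w/b/c.
  by field; rewrite gt_eqF.
have iz e : 0 < e -> (distribution P X).-integrable setT (EFin \o z e) /\
    (\int[distribution P X]_x (z e x)%:E = 0)%E.
  move=> e0; have mz : measurable_fun setT (z e).
    apply: measurable_funM.
      by apply: measurableT_comp => //; apply: measurableT_comp => //; exact: measurable_funM.
    apply: measurable_funB; last exact: measurable_funM.
    by apply: measurable_funB => //; exact: measurable_funM.
  rewrite zE in mz *.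
  apply: (@damped_divergence_theorem (field2 G H nu) (dir2 G H nu) (d_field2 G H nu)) => //.
  - exact: polymx_field2.
  - exact: polymx_d_field2.
  - exact: pderivmx_field2.
have b0 : 0 < b by rewrite mulr_gt0//; lra.
have t10 := qmom1_ge0 pS pO; have t20 := qmom2_ge0 pS pO.
have u0 x : 0 <= u x by rewrite !mulr_ge0// ltW.
have w0 x : 0 <= w x.
  have t30 := qmom3_ge0 pS pO x.
  have e2 : 0 <= nu - 2 by lra.
  have nu0' := ltW nu0.
  have h1 : 0 <= (nu - 2) * (nu * t2 x + t3 x).
    by apply: mulr_ge0 => //; apply: addr_ge0 => //; exact: mulr_ge0.
  have h2 : 0 <= nu * t1 x ^+ 2 by rewrite mulr_ge0// exprn_ge0.
  have h3 : 0 <= t1 x * t2 x by rewrite mulr_ge0.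
  by rewrite mulr_ge0// addr_ge0// addr_ge0.
(* The constant [2 / c] makes the first term [2 * nu * t1], which bounds the contribution of
   [t1 ^+ 2]. The terms in [t2], [t3] and [t1 * t2] are all bounded by multiples of [t2], using
   [t3 <= t1 * t2]. *)
have hw e x : 0 < e <= 1 -> e * w x * expR (- (e * t1 x)) <=
    2 / c * u x + 2 * ((nu - 2) * (nu + 1) + 1) * t2 x.
  move=> /andP[e0 e1].
  have -> : 2 / c * u x = 2 * nu * t1 x by rewrite /u; field; rewrite gt_eqF.
  have := mul_expRN_le1 (e * t1 x).
  have p0 := expR_gt0 (- (e * t1 x)).
  have p1 : expR (- (e * t1 x)) <= 1.
    by rewrite -expR0 ler_expR oppr_le0 mulr_ge0// ltW.
  have := t10 x; have := t20 x; have := qmom3_le pS pO x.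
  move: (expR _) p0 p1 => p p0 p1; rewrite /w.
  move: (t1 x) (t2 x) (t3 x) => x1 x2 x3 h1 h2 h3 h4.
  have ep : 0 <= e * p by rewrite mulr_ge0// ltW.
  have q1 : e * p * x2 <= x2 by rewrite ler_piMl// mulr_ile1// ltW.
  have q2 : e * p * (x1 * x2) <= x2.
    by rewrite (_ : _ * _ = (e * x1 * p) * x2) ?ler_piMl//; ring.
  have q3 : e * p * x3 <= x2 by rewrite (le_trans _ q2)// ler_wpM2l.
  have q4 : e * p * x1 ^+ 2 <= x1.
    by rewrite (_ : _ * _ = (e * x1 * p) * x1) ?ler_piMl//; ring.
  rewrite (_ : _ * _ * p = 2 * ((nu - 2) * (nu * (e * p * x2) + e * p * x3) +
    nu * (e * p * x1 ^+ 2) + e * p * (x1 * x2))); last by ring.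
  rewrite (_ : _ + _ * x2 = 2 * ((nu - 2) * (nu * x2 + x2) + nu * x1 + x2)); last by ring.
  have e2 : 0 <= nu - 2 by lra.
  have nu0' := ltW nu0.
  by rewrite ler_wpM2l// !lerD// ?ler_wpM2l// lerD// ler_wpM2l.
have iu : (distribution P X).-integrable setT (EFin \o u).
  rewrite (_ : EFin \o u = fun x => ((nu * c)%:E * (EFin \o t1) x)%E)//.
  exact: integrableZl.
rewrite -[RHS]integralZl//.
apply: (@damped_limit_integral _ _ _ _ t1 u t2 w b (2 / c)
  (2 * ((nu - 2) * (nu + 1) + 1))) => //.
- by move=> e /iz[].
- by move=> e /iz[].
Qed.

End matrix_T_moments.

(** An infinite [x] would make the left side infinite, so the linear relations themselves yield
    finite moments. *)
Lemma mule_fin_solve (R : realType) (a c : R) (x : \bar R) : 0 < a ->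
  (a%:E * x = c%:E)%E -> x = (c / a)%:E.
Proof.
move=> a0; case: x => [r| |].
- by rewrite -EFinM => -[<-]; rewrite mulrAC divff ?mul1r// gt_eqF.
- by rewrite gt0_muley ?lte_fin.
- by rewrite gt0_muleNy ?lte_fin.
Qed.

(** * Solving for the two expectations *)

Section matrix_T_expectations.
Context {R : realType} {d m : nat} (Sigma : 'M[R]_d) (Omega : 'M[R]_m) (nu : R).
Hypotheses (d0 : (0 < d)%N) (pS : posdefmx Sigma) (pO : posdefmx Omega).
Context {disp : measure_display} {W : measurableType disp} (P : probability W R).
Variable X : {RV P >-> 'M[R]_(d, m)}.
Hypothesis TX : matrix_T_distributed X nu Sigma Omega.

Lemma expectation_qmom k : (forall x, 0 <= qmom (invmx Sigma) (invmx Omega) k x) ->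
  ('E_P[(fun w => let D := standardize Sigma Omega (X w) in \tr ((D *m D^T) ^+ k))] =
   \int[distribution P X]_x (qmom (invmx Sigma) (invmx Omega) k x)%:E)%E.
Proof.
move=> q0; rewrite unlock ge0_integral_distribution//.
- by apply: eq_integral => w _; rewrite /= mxtrace_standardize_gramX.
- by apply/measurable_EFinP; apply: measurable_polyfun; exact: polyfun_qmom.
Qed.

Lemma expectation_gram : 2 < nu ->
  ('E_P[(fun w => let D := standardize Sigma Omega (X w) in \tr (D *m D^T))]
   = (m%:R * d%:R * nu / (nu - 2))%:E)%E.
Proof.
move=> nu2; have nu0 : 0 < nu by lra.
have [_ h] := qmom1_moment pS pO nu0 TX d0 nu2.
have -> : (fun w => let D := standardize Sigma Omega (X w) in \tr (D *m D^T)) =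
    (fun w => let D := standardize Sigma Omega (X w) in \tr ((D *m D^T) ^+ 1)).
  by apply/funext => w; rewrite /= expr1.
rewrite (expectation_qmom (@qmom1_ge0 _ _ _ _ _ pS pO)).
rewrite (mule_fin_solve _ h) ?subr_gt0//; congr (_ / _)%:E; ring.
Qed.

Lemma expectation_gram_sqr : 4 < nu ->
  ('E_P[(fun w => let D := standardize Sigma Omega (X w) in \tr ((D *m D^T) ^+ 2))]
   = (m%:R * d%:R * nu ^+ 2 * ((m%:R + d%:R) * (nu - 2) + nu + m%:R * d%:R)
      / ((nu - 1) * (nu - 2) * (nu - 4)))%:E)%E.
Proof.
move=> nu4; have nu0 : 0 < nu by lra.
have nu2 : 2 < nu by lra.
have [_ h1] := qmom1_moment pS pO nu0 TX d0 nu2.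
have h2 := qmom2_moment pS pO nu0 TX d0 nu4.
rewrite (mule_fin_solve _ h1) ?subr_gt0// -EFinM in h2.
rewrite (expectation_qmom (@qmom2_ge0 _ _ _ _ _ pS pO)).
have b0 : 0 < (nu - 1) * (nu - 4) by apply: mulr_gt0; lra.
rewrite (mule_fin_solve b0 h2).
congr (_%:E); field.
by rewrite !gt_eqF//; lra.
Qed.

End matrix_T_expectations.

(** * Asymptotics for many degrees of freedom *)

Lemma cvg_pinfty_invr (R : realType) : (x : R)^-1 @[x --> +oo] --> (0 : R).
Proof.
apply/cvgrPdist_lt => e e0; near=> x.
have x0 : 0 < x by near: x; apply: nbhs_pinfty_gt; rewrite num_real.
rewrite sub0r normrN gtr0_norm ?invr_gt0// invf_plt ?posrE//.
by near: x; apply: nbhs_pinfty_gt; rewrite num_real.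
Unshelve. all: by end_near. Qed.

(** The substitution [u = nu^-1] reduces the equivalence at infinity to the limit at 0 of an
    explicit rational function. *)
Lemma asymp_equiv_of_eq (R : realType) (f h : R -> R) (b : R) :
  (\forall x \near +oo, f x = h x^-1 * b) -> h u @[u --> (0 : R)] --> (1 : R) ->
  asymp_equiv f (fun=> b).
Proof.
move=> fh h1; exists (fun x => h x^-1 - 1).
  rewrite -[X in _ --> X](subrr 1); apply: cvgB; last exact: cvg_cst.
  by apply: cvg_comp h1; exact: cvg_pinfty_invr.
by move: fh; apply: filterS => x ->; rewrite addrC subrK.
Qed.

Theorem lemma1 (R : realType) (d m : nat)
    (d_gt0 : (0 < d)%N) (m_gt0 : (0 < m)%N)
    (Sigma : 'M[R]_d) (Omega : 'M[R]_m)
    (Sigma_posdef : posdefmx Sigma) (Omega_posdef : posdefmx Omega) :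
  [/\ forall (disp : measure_display) (W : measurableType disp)
        (P : probability W R) (X : {RV P >-> 'M[R]_(d, m)}) (nu : R),
        2 < nu -> matrix_T_distributed X nu Sigma Omega ->
        ('E_P[(fun w => let D := standardize Sigma Omega (X w) in
                        \tr (D *m D^T))]
         = (m%:R * d%:R * nu / (nu - 2))%:E)%E,
      forall (disp : measure_display) (W : measurableType disp)
        (P : probability W R) (X : {RV P >-> 'M[R]_(d, m)}) (nu : R),
        4 < nu -> matrix_T_distributed X nu Sigma Omega ->
        ('E_P[(fun w => let D := standardize Sigma Omega (X w) in
                        \tr ((D *m D^T) ^+ 2))]
         = (m%:R * d%:R * nu ^+ 2
              * ((m%:R + d%:R) * (nu - 2) + nu + m%:R * d%:R)
            / ((nu - 1) * (nu - 2) * (nu - 4)))%:E)%E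
    & forall (disp : R -> measure_display)
        (W : forall nu : R, measurableType (disp nu))
        (P : forall nu : R, probability (W nu) R)
        (X : forall nu : R, {RV (P nu) >-> 'M[R]_(d, m)}),
        (forall nu : R, 0 < nu ->
           matrix_T_distributed (X nu) nu Sigma Omega) ->
        asymp_equiv
          (fun nu : R => fine 'E_(P nu)[(fun w =>
             let D := standardize Sigma Omega (X nu w) in \tr (D *m D^T))])
          (fun=> m%:R * d%:R)
        /\
        asymp_equiv
          (fun nu : R => fine 'E_(P nu)[(fun w =>
             let D := standardize Sigma Omega (X nu w) in
             \tr ((D *m D^T) ^+ 2))])
          (fun=> m%:R * d%:R * (m%:R + d%:R + 1))].
Proof.
split.
- by move=> disp W P X nu nu2 TX; exact: expectation_gram.
- by move=> disp W P X nu nu4 TX; exact: expectation_gram_sqr.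
move=> disp W P X TX.
have cvglin (k : R) : 1 - k * u @[u --> (0 : R)] --> (1 : R).
  rewrite [X in _ --> X](_ : 1 = 1 - k * 0); last by rewrite mulr0 subr0.
  apply: cvgB; first exact: cvg_cst.
  by apply: cvgMr; exact: cvg_id.
split.
- apply: (@asymp_equiv_of_eq _ _ (fun u => (1 - 2 * u)^-1)).
    near=> nu; have nu2 : 2 < nu by near: nu; exact: nbhs_pinfty_gt.
    have nu0 : 0 < nu by lra.
    rewrite (expectation_gram d_gt0 Sigma_posdef Omega_posdef (TX nu nu0))//=; field.
    by rewrite !gt_eqF//; lra.
  by rewrite -[X in _ --> X]invr1; apply: cvgV => //; rewrite oner_eq0.
- set s : R := m%:R + d%:R; set p : R := m%:R * d%:R.
  have s0 : 0 <= s by rewrite addr_ge0.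
  have s1 : s + 1 != 0 by rewrite gt_eqF//; lra.
  (* Numerator and denominator are divided by [nu ^+ 3] and by the limit factor [s + 1]; [1 * u] is
     kept to match [cvglin]. *)
  apply: (@asymp_equiv_of_eq _ _ (fun u => (s * (1 - 2 * u) + 1 + p * u) / (s + 1)
     * (1 - 1 * u)^-1 * (1 - 2 * u)^-1 * (1 - 4 * u)^-1)).
    near=> nu; have nu4 : 4 < nu by near: nu; exact: nbhs_pinfty_gt.
    have nu0 : 0 < nu by lra.
    rewrite (expectation_gram_sqr d_gt0 Sigma_posdef Omega_posdef (TX nu nu0))//= -/s -/p; field.
    by rewrite s1 !gt_eqF//; lra.
  rewrite [X in _ --> X](_ : 1 = (s * 1 + 1 + p * 0) / (s + 1) * 1^-1 * 1^-1 * 1^-1); last first.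
    by rewrite mulr1 mulr0 addr0 divff// invr1 !mulr1.
  do 3 (apply: cvgM; last by apply: cvgV => //; rewrite oner_eq0).
  apply: cvgMl; apply: cvgD; last by apply: cvgMr; exact: cvg_id.
  by apply: cvgD; [exact: cvgMr|exact: cvg_cst].
Unshelve. all: by end_near. Qed.
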